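(* Let $S$ be a nonempty, closed, convex subset of a Banach space $E$ and let $A, B: S \to \mathcal{P}_{cl,cv}(E)$ be two multi-valued mappings with weakly sequentially closed graphs such that: (i) $A$ is hemi-weakly compact and countably $\mathcal{D}$-set-Lipschitzian with $\mathcal{D}$-function $\Phi$; (ii) $B$ is weakly compact; (iii) $(A+B)(S)$ is a bounded subset of $S$. If $\Phi(r)\le r$ for all $r>0$, then the operator inclusion $u\in A(u)+B(u)$ has at least one solution $u$ in $S$.
   Context: $\mathcal{P}_{cl,cv}(E)$ is the family of all nonempty closed convex subsets of $E$. For a multi-valued $F$ on $S$ and $M\subset S$, $F(M)=\bigcup_{x\in M}F(x)$; $(A+B)(u)=A(u)+B(u)$. $\rightharpoonup$ denotes weak convergence. $F:S\to\mathcal P(E)$ (nonempty subsets) has a weakly sequentially closed graph if whenever $x_n\in S$, $x_n\rightharpoonup x\in S$, $y_n\in F(x_n)$ and $y_n\rightharpoonup y$ in $E$, then $y\in F(x)$. $F$ is hemi-weakly compact if, for every sequence $(x_n)$ in $S$ and every choice $y_n\in F(x_n)$ such that $(x_n-y_n)$ converges weakly, $(x_n)$ has a weakly convergent subsequence. $F$ is weakly compact if $F(M)$ is relatively weakly compact for every bounded $M\subset S$. $\beta$ is the De Blasi measure of weak noncompactness: for bounded $W\subset E$, $\beta(W)=\inf\{\varepsilon>0:\ \exists K\subset E \text{ weakly compact},\ W\subset K+\mathcal{B}_E(\varepsilon)\}$, where $\mathcal{B}_E(\varepsilon)$ is the closed ball of radius $\varepsilon$ centred at the origin. $F$ is countably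 $\mathcal{D}$-set-Lipschitzian with $\mathcal{D}$-function $\Phi$ if $\Phi:\mathbb{R}_+\to\mathbb{R}_+$ is continuous, nondecreasing, $\Phi(0)=0$, and $\beta(F(W))\le\Phi(\beta(W))$ for every countable bounded subset $W$ of $S$ with $F(W)$ bounded. *)

(* Defs.v *)
From HB Require Import structures.
From mathcomp Require Import all_boot all_order all_algebra.
From mathcomp Require Import all_classical all_reals all_analysis.

Set Implicit Arguments.
Unset Strict Implicit.
Unset Printing Implicit Defensive.

Import Order.TTheory GRing.Theory Num.Theory.
Import numFieldNormedType.Exports.

Local Open Scope classical_set_scope.
Local Open Scope ring_scope.

Section weak_topology.
Context {R : realType}.
Implicit Type E : normedModType R.

Definition topological_dual E := {f : {linear E -> R^o} | continuous f}.

(* The carrier of E with the coarsest topology making every element of the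
   topological dual continuous; [sup_topology] is the topology generated by
   the union of the given ones. *)
Definition weak_space E : topologicalType :=
  sup_topology (fun f : topological_dual E =>
    Topological.on (initial_topology (sval f : E -> R^o))).

Definition weakly_cvg_to E (u : nat -> E) (x : E) :=
  (u : nat -> weak_space E) @ \oo --> (x : weak_space E).

Definition weakly_convergent E (u : nat -> E) := exists x : E, weakly_cvg_to u x.

Definition has_weakly_convergent_subseq E (u : nat -> E) :=
  exists2 k : nat -> nat, {homo k : m n / (m < n)%N} &
    weakly_convergent (u \o k).

Definition weakly_compact E (K : set E) := @compact (weak_space E) K.

Definition relatively_weakly_compact E (W : set E) :=
  @precompact (weak_space E) W.

End weak_topology.

Definition set_add (V : nmodType) (X Y : set V) : set V :=
  [set x + y | x in X & y in Y].

(* The De Blasi measure of weak noncompactness; it is meaningful for bounded W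
   only, since for unbounded W the infimum is taken over the empty set (and
   [inf set0 = 0]). *)
Definition de_blasi (R : realType) (E : normedModType R) (W : set E) : R :=
  inf [set e : R | 0 < e /\
    exists2 K : set E, weakly_compact K &
      W `<=` set_add K (closed_ball (0 : E) e)].

(* A multi-valued mapping on S is represented by a function on the whole space;
   all the notions below only involve its values at the points of S. *)
Section multivalued_mappings.
Context {R : realType} {E : normedModType R}.
Implicit Types (S W : set E) (F G : E -> set E) (Phi : R -> R).

Definition mv_image F W : set E := \bigcup_(x in W) F x.

Definition mv_add F G : E -> set E := fun u => set_add (F u) (G u).

Definition closed_convex_valued S F := forall x, S x ->
  [/\ F x !=set0, closed (F x) & convex_set (F x)].

Definition weakly_seq_closed_graph S F :=
  forall (x_ y_ : nat -> E) (x y : E),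
    (forall n, S (x_ n)) -> S x -> weakly_cvg_to x_ x ->
    (forall n, F (x_ n) (y_ n)) -> weakly_cvg_to y_ y ->
    F x y.

Definition hemi_weakly_compact S F :=
  forall x_ y_ : nat -> E,
    (forall n, S (x_ n)) -> (forall n, F (x_ n) (y_ n)) ->
    weakly_convergent (fun n => x_ n - y_ n) ->
    has_weakly_convergent_subseq x_.

Definition weakly_compact_mapping S F :=
  forall M, M `<=` S -> bounded_set M ->
    relatively_weakly_compact (mv_image F M).

(* Functions from the nonnegative reals to themselves are represented by
   functions on R, constrained on [0, +oo[ only. *)
Definition D_function Phi :=
  [/\ forall r, 0 <= r -> 0 <= Phi r,
      {within `[0, +oo[, continuous Phi},
      {in `[0, +oo[ &, {homo Phi : r s / r <= s}} &
      Phi 0 = 0].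

Definition countably_D_set_lipschitzian S F Phi :=
  D_function Phi /\
  forall W, W `<=` S -> countable W -> bounded_set W ->
    bounded_set (mv_image F W) ->
    de_blasi (mv_image F W) <= Phi (de_blasi W).

End multivalued_mappings.

(* Main.v *)
(** Fix [x0] in [S] and [0 < lam < 1], and replace [A + B] by the relaxed
    mapping [x |-> lam (A x + B x) + (1 - lam) x0].  For a selection [f] of it
    let [C] be the smallest set containing [x0] and closed under [f] and under
    midpoints.  It is countable and lies in the hull of [x0] and [f C]; by
    Krein's theorem and the Lipschitz hypothesis its De Blasi measure [beta]
    satisfies [beta <= lam beta], so that the closure [D] of [C] is weakly
    compact and convex.  On the separable set [D] countably many functionals
    determine the weak topology, so a Knaster-Kuratowski-Mazurkiewicz argument
    on finite subsets of [C] gives a point [z] of [D] that no half-space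
    separates from the weak limits of [f (u n)], where [u n] in [C] tends
    weakly to [z].  These limits are in the relaxed mapping at [z], which is
    closed and convex: [z] is a solution of the relaxed inclusion.  Letting
    [lam] tend to 1, the weak compactness of [B] and the hemi-weak compactness
    of [A] provide a subsequence of solutions converging to one of the
    inclusion. *)
From HB Require Import structures.
Require Import Defs.
From mathcomp Require Import all_boot zify.

Set Implicit Arguments.
Unset Strict Implicit.
Unset Printing Implicit Defensive.

(** * Scarf's lemma *)

(** The hypothesis [Phi r <= r] makes [A + B] at best nonexpansive for the De Blasi measure; the
    factor [lam] provides the strict inequality that forces the measure of [C] to vanish. The
    Lipschitz condition is available on countable sets only, so [C] is generated from one point by
    two operations, with midpoints instead of all convex combinations. The selection [f] has no
    continuity, which excludes a direct use of Schauder's theorem: as in Kakutani's theorem, one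
    looks for a point that is almost a convex combination of values of [f] at nearby points, and the
    closed graphs recover the inclusion in the limit. The covering lemma behind this comes from
    Scarf's combinatorial argument, which accepts arbitrary labels. Krein's theorem is obtained
    without measure theory: limits of finitely supported means along an ultrafilter stand for the
    representing measures, and Eberlein's minimisation of a quadratic mean stands for dominated
    convergence. *)

Lemma even_sum (J : finType) (P : pred J) (F : J -> nat) :
  (forall j, P j -> ~~ odd (F j)) -> ~~ odd (\sum_(j | P j) F j).
Proof.
move=> F_even; elim/big_ind: _ => // m n; rewrite oddD.
by move=> /negbTE -> /negbTE ->.
Qed.

Section facets.
Context {U I : finType}.
Variables (col : U -> I) (i0 : I) (X : {set U}).

Definition almost_colourful_facets : {set U} :=
  [set y in X | col @: (X :\ y) == [set~ i0]].

(** If deleting [y] leaves exactly the colours other than [i0], then [X :\ y] is injectively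
    coloured by cardinality. The colour of [y] is not [i0], for otherwise [X] would show all
    colours, so exactly one other element [y'] shares it. Only [y] and [y'] can be deleted: the
    number is 0 or 2. *)
Lemma even_almost_colourful_facets : #|X| = #|I| -> col @: X != setT ->
  ~~ odd #|almost_colourful_facets|.
Proof.
move=> X_card X_col; set S := almost_colourful_facets.
have facet_inj y : y \in S -> {in X :\ y &, injective col}.
  rewrite inE => /andP[Xy /eqP colE]; apply/imset_injP.
  rewrite colE cardsC1 -X_card (cardsD1 y X) Xy; exact/eqP.
have [->|/set0Pn[y Sy]] := eqVneq S set0; first by rewrite cards0.
have := Sy; rewrite inE => /andP[Xy /eqP colE].
have coly : col y != i0.
  apply: contra_neq X_col => coly; apply/setP => i; rewrite in_setT.
  have [->|ii0] := eqVneq i i0; first by rewrite -coly imset_f.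
  have : i \in col @: (X :\ y) by rewrite colE !inE.
  by move=> /imsetP[x]; rewrite inE => /andP[_ Xx] ->; rewrite imset_f.
have : col y \in col @: (X :\ y) by rewrite colE !inE.
move=> /imsetP[y' y'X yy'].
have := y'X; rewrite !inE => /andP[y'y Xy'].
suff -> : S = [set y; y'] by rewrite cards2 eq_sym y'y.
apply/setP => x; rewrite !inE; apply/idP/idP => [/andP[Xx colx]|].
  apply/negPn/negP; rewrite negb_or => /andP[xy xy'].
  have Sx : x \in S by rewrite inE Xx.
  move/eqP: y'y; apply; apply: (facet_inj x Sx) => //.
    by rewrite !inE eq_sym xy'.
  by rewrite !inE eq_sym xy.
move=> /orP[/eqP ->|/eqP ->]; first by rewrite Xy colE eqxx.
rewrite Xy' -colE /= eqEsubset.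
apply/andP; split; apply/subsetP => _ /imsetP[u uX ->].
  have [->|uy] := eqVneq u y; first by rewrite yy' imset_f.
  by rewrite imset_f// !inE uy; move: uX; rewrite !inE => /andP[].
have [->|uy'] := eqVneq u y'; last first.
  by rewrite imset_f// !inE uy'; move: uX; rewrite !inE => /andP[].
by rewrite -yy' imset_f// !inE eq_sym y'y.
Qed.

End facets.

(* Scarf's ordinal version of a triangulation.  The slack element [inr i]
   stands for the facet [i] of the simplex; an element [t] of [T] is at height
   [rk i t] above it. *)
Section scarf.
Context {T I : finType}.
Variables (rk : I -> T -> nat) (rk_inj : forall i, injective (rk i)).
Implicit Types (X Y : {set T + I}) (i j : I) (s t x : T).

(** Equivalently, no [t] is, for every facet [i] outside [Y], strictly above some point of [Y] in
    the order [rk i]: the cell cut out by [Y] is empty. A facet in [Y] imposes nothing in its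
    direction, where the cell reaches the boundary. *)
Definition dominant Y := [forall t, exists i, (inr i \notin Y) &&
  [forall s, (inl s \in Y) ==> (rk i t <= rk i s)]].

Lemma dominantP Y : reflect (forall t, exists2 i, inr i \notin Y &
    forall s, inl s \in Y -> rk i t <= rk i s) (dominant Y).
Proof.
apply: (iffP forallP) => Y_dom t.
  have /existsP[i /andP[iY /forallP tY]] := Y_dom t.
  by exists i => // s Ys; have /implyP := tY s; apply.
have [i iY tY] := Y_dom t; apply/existsP; exists i; rewrite iY.
by apply/forallP => s; apply/implyP; exact: tY.
Qed.

Arguments dominantP {Y}.

Lemma dominant_sub X Y : Y \subset X -> dominant X -> dominant Y.
Proof.
move=> /subsetP YX /dominantP X_dom; apply/dominantP => t.
have [i iX tX] := X_dom t; exists i.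
  by apply: contra iX; exact: YX.
by move=> s /YX; exact: tX.
Qed.

Definition points Y : {set T} := [set t | inl t \in Y].
Definition free_facets Y : {set I} := [set i | inr i \notin Y].

Lemma card_points_free Y : #|Y| + #|free_facets Y| = #|points Y| + #|I|.
Proof.
have -> : #|Y| = #|points Y| + #|[set i | inr i \in Y]|.
  rewrite -!sum1_card big_sumType /=.
  by congr (_ + _); apply: eq_bigl => ?; rewrite inE.
rewrite -addnA; congr (_ + _); rewrite -cardsUI.
have -> : [set i | inr i \in Y] :|: free_facets Y = setT.
  by apply/setP => i; rewrite !inE orbN.
have -> : [set i | inr i \in Y] :&: free_facets Y = set0.
  by apply/setP => i; rewrite !inE andbN.
by rewrite cards0 addn0 cardsT.
Qed.

Definition completions Y : {set T + I} :=
  [set z | (z \notin Y) && dominant (z |: Y)].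

Section internal_facet.
Variables (Y : {set T + I}) (Y_card : #|Y|.+1 = #|I|).

Let D := free_facets Y.

Lemma card_free : #|D| = #|points Y|.+1.
Proof. by have := card_points_free Y; rewrite -/D -Y_card; lia. Qed.

Hypothesis Y_dom : dominant Y.
Variable m : I -> T.
Hypothesis mY : forall i, inl (m i) \in Y.
Hypothesis m_le : forall i s, inl s \in Y -> rk i (m i) <= rk i s.

Lemma lowest_eq i s : inl s \in Y ->
  (forall s', inl s' \in Y -> rk i s <= rk i s') -> m i = s.
Proof.
move=> Ys s_le; apply: (rk_inj (i := i)); apply/eqP.
by rewrite eqn_leq m_le// s_le.
Qed.

Let onto j := forall s, inl s \in Y -> exists2 i, i \in D :\ j & m i = s.

Lemma onto_inj j : j \in D -> onto j -> {in D :\ j &, injective m}.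
Proof.
move=> Dj j_onto; apply/imset_injP.
have -> : m @: (D :\ j) = points Y.
  apply/setP => s; rewrite inE; apply/idP/idP.
    by move=> /imsetP[i _ ->].
  by move=> /j_onto[i iD <-]; rewrite imset_f.
by have := cardsD1 j D; rewrite Dj card_free; lia.
Qed.

(** Dominance applied to the points of [Y] themselves shows that each is the lowest for some free
    facet. There is one more free facet than points, so exactly two free facets share their lowest
    point; [onto j] says that [j] can be spared, which holds for these two only. *)
Lemma exists_lowest_collision : exists i1 i2,
  [/\ [/\ i1 \in D, i2 \in D & i1 != i2], onto i1, onto i2 &
      forall j, j \in D -> onto j -> j = i1 \/ j = i2].
Proof.
have D_onto s : inl s \in Y -> exists2 i, i \in D & m i = s.
  move=> Ys; have [i iY si] := elimT dominantP Y_dom s.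
  by exists i; [rewrite inE|exact: lowest_eq].
have m_ninj : ~~ [forall i1 in D, forall i2 in D, (m i1 == m i2) ==> (i1 == i2)].
  apply/negP => m_inj; suff : #|m @: D| = #|D|.
    have : m @: D \subset points Y.
      by apply/subsetP => _ /imsetP[i _ ->]; rewrite inE.
    by move=> /subset_leq_card; rewrite card_free; lia.
  apply/eqP/imset_injP => i1 i2 Di1 Di2 m12; apply/eqP.
  move/forall_inP/(_ _ Di1)/forall_inP/(_ _ Di2)/implyP: m_inj; apply.
  exact/eqP.
move: m_ninj; rewrite negb_forall_in => /exists_inP[i1 Di1].
rewrite negb_forall_in => /exists_inP[i2 Di2].
rewrite negb_imply => /andP[/eqP m12 i12].
have onto_of j j' : j != j' -> j' \in D -> m j = m j' -> onto j.
  move=> jj' Dj' mjj' s /D_onto[i Di <-].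
  have [->|ij] := eqVneq i j; last by exists i; rewrite ?in_setD1 ?ij.
  by exists j'; rewrite ?in_setD1 1?eq_sym ?jj'.
exists i1, i2; split => //.
- exact: onto_of m12.
- by apply: (onto_of i2 i1) => //; rewrite eq_sym.
move=> j Dj j_onto; have [->|ji1] := eqVneq j i1; first by left.
have [->|ji2] := eqVneq j i2; first by right.
move/eqP: i12; case; apply: (onto_inj Dj j_onto) => //.
  by rewrite in_setD1 Di1 eq_sym ji1.
by rewrite in_setD1 Di2 eq_sym ji2.
Qed.

Let above j := [set t | [forall i in D :\ j, rk i (m i) < rk i t]].

Lemma aboveP j t : reflect (forall i, i \in D -> i != j -> rk i (m i) < rk i t)
  (t \in above j).
Proof.
rewrite inE; apply: (iffP forall_inP) => h i.
  by move=> Di ij; apply: h; rewrite in_setD1 ij.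
by rewrite in_setD1 => /andP[ij Di]; exact: h.
Qed.

(** The pivot: the wall in direction [j] is lowered until it meets a new point, the highest of
    [above j] in the order [rk j], or, when there is none, until it reaches the facet [j] itself. *)
Let completes j (z : T + I) := match z with
  | inl x => x \in above j /\ forall t, t \in above j -> rk j t <= rk j x
  | inr j' => j' = j /\ above j = set0
  end.

Lemma completes_unique j z z' : completes j z -> completes j z' -> z = z'.
Proof.
case: z z' => [x|j1] [x'|j2] /=.
- move=> [x_above x_max] [x'_above x'_max]; congr inl; apply: (rk_inj (i := j)).
  by apply/eqP; rewrite eqn_leq x'_max// x_max.
- by move=> [x_above _] [_ a0]; rewrite a0 inE in x_above.
- by move=> [_ a0] [x_above _]; rewrite a0 inE in x_above.
- by move=> [-> _] [-> _].
Qed.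

Lemma exists_completes j : j \in D -> onto j ->
  exists2 z, z \in completions Y & completes j z.
Proof.
move=> Dj j_onto; have [a0|/set0Pn[t0 at0]] := eqVneq (above j) set0.
  exists (inr j); last by [].
  rewrite inE; apply/andP; split; first by move: Dj; rewrite inE.
  apply/dominantP => t; have : t \notin above j by rewrite a0 inE.
  rewrite inE negb_forall_in => /exists_inP[i]; rewrite !inE -leqNgt.
  move=> /andP[ij iY] ti; exists i => [|s]; first by rewrite !inE negb_or; apply/andP.
  by rewrite !inE /= => Ys; exact: leq_trans ti (m_le _ _).
have [x x_above x_max] : exists2 x, x \in above j &
    forall t, t \in above j -> rk j t <= rk j x.
  by case: (arg_maxnP (rk j) at0) => x x_above x_max; exists x.
exists (inl x) => //; rewrite inE.
have xY : inl x \notin Y.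
  apply/negP => /j_onto[i]; rewrite in_setD1 => /andP[ij Di] mx.
  by have := aboveP _ _ x_above i Di ij; rewrite mx ltnn.
rewrite xY; apply/dominantP => t.
have [t_above|t_nabove] := boolP (t \in above j); last first.
  move: t_nabove; rewrite inE negb_forall_in => /exists_inP[i].
  rewrite in_setD1 -leqNgt => /andP[ij Di] ti.
  exists i => [|s]; first by rewrite !inE /=; move: Di; rewrite inE.
  rewrite !inE => /orP[/eqP[->]|Ys]; last exact: leq_trans ti (m_le _ _).
  exact/ltnW/(leq_ltn_trans ti)/(aboveP _ _ x_above i).
exists j => [|s]; first by rewrite !inE /=; move: Dj; rewrite inE.
rewrite !inE => /orP[/eqP[->]|Ys]; first exact: x_max.
apply: leq_trans (x_max t t_above) _.
(* As [x] is strictly above the lowest points in all free directions but [j], dominance of [Y] at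
   [x] can only come from [j]. *)
have [i iY xi] := elimT dominantP Y_dom x.
have [ij|ij] := eqVneq i j; first by rewrite -ij; exact: xi.
have := aboveP _ _ x_above i; rewrite inE iY => /(_ isT ij).
by rewrite ltnNge xi.
Qed.

Lemma completions_complete z : z \in completions Y ->
  exists j, [/\ j \in D, onto j & completes j z].
Proof.
rewrite inE; case: z => [x|j] /andP[zY /dominantP z_dom].
  have [j jY xj] := z_dom x.
  have Dj : j \in D by move: jY; rewrite !inE.
  have lowest s : inl s \in Y -> exists2 i, i \in D :\ j & m i = s /\ rk i s <= rk i x.
    move=> Ys; have [i iY si] := z_dom s.
    have mi : m i = s.
      by apply: lowest_eq => // s' Ys'; apply: si; rewrite in_setU1 Ys' orbT.
    have six : rk i s <= rk i x by apply: si; rewrite in_setU1 eqxx.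
    exists i => //; rewrite in_setD1; apply/andP; split; last by move: iY; rewrite !inE.
    apply: contraNneq zY => ij; rewrite ij in six; suff -> : x = s by [].
    by apply: (rk_inj (i := j)); apply/eqP; rewrite eqn_leq six xj// in_setU1 Ys orbT.
  have j_onto : onto j by move=> s /lowest[i Di []]; exists i.
  exists j; split => //; split.
    apply/aboveP => i Di ij.
    have [i' Di' [mi' mi'x]] := lowest (m i) (mY i).
    have ii' : i' = i by apply: (onto_inj Dj j_onto) => //; rewrite in_setD1 ij.
    rewrite ii' in mi'x; rewrite ltn_neqAle mi'x andbT.
    by apply: contraNneq zY => /rk_inj <-; exact: mY.
  move=> t /aboveP t_above; have [i iY ti] := z_dom t.
  have [ij|ij] := eqVneq i j; first by rewrite -ij; apply: ti; rewrite in_setU1 eqxx.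
  have Di : i \in D by move: iY; rewrite !inE.
  have := t_above i Di ij; rewrite ltnNge ti// in_setU1; apply/orP; right; exact: mY.
have Dj : j \in D by rewrite inE.
have free_z i : inr i \notin inr j |: Y -> i \in D :\ j.
  by rewrite !inE negb_or.
exists j; split => //.
  move=> s Ys; have [i iY si] := z_dom s; exists i; first exact: free_z.
  by apply: lowest_eq => // s' Ys'; apply: si; rewrite in_setU1 Ys' orbT.
split => //; apply/setP => t; rewrite in_set0; apply/negbTE/negP => /aboveP t_above.
have [i /free_z] := z_dom t; rewrite in_setD1 => /andP[ij Di] ti.
have := t_above i Di ij; rewrite ltnNge ti// in_setU1; apply/orP; right; exact: mY.
Qed.

(** A completion is a pivot along a direction that can be spared, and there are two such directions.
    Their pivots differ: a common point would be strictly above the lowest point of [Y] in every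
    free direction, against dominance, and a common facet would be both [i1] and [i2]. *)
Lemma card_completions_internal : #|completions Y| = 2.
Proof.
have [i1 [i2 [[Di1 Di2 i12] onto1 onto2 only12]]] := exists_lowest_collision.
have [z1 Yz1 z1c] := exists_completes Di1 onto1.
have [z2 Yz2 z2c] := exists_completes Di2 onto2.
have z12 : z1 != z2.
  apply/eqP => z12; rewrite -z12 in z2c; case: z1 z1c z2c {Yz1 z12} => [x|j] /=.
    move=> [/aboveP x1 _] [/aboveP x2 _].
    have [i iY xi] := elimT dominantP Y_dom x.
    have Di : i \in D by rewrite inE.
    have : rk i (m i) < rk i x.
      have [ii1|ii1] := eqVneq i i1; last exact: x1.
      by apply: x2 => //; rewrite ii1.
    by rewrite ltnNge xi.
  by move=> [-> _] [i21 _]; rewrite i21 eqxx in i12.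
suff -> : completions Y = [set z1; z2] by rewrite cards2 z12.
apply/setP => z; rewrite in_set2; apply/idP/orP => [Yz|[/eqP ->|/eqP ->]] //.
have [j [Dj j_onto jz]] := completions_complete Yz.
have [ji|ji] := only12 j Dj j_onto; rewrite ji in jz.
  by left; apply/eqP; exact: completes_unique jz z1c.
by right; apply/eqP; exact: completes_unique jz z2c.
Qed.

End internal_facet.

(** [Y] consists of all the slack elements but one, [i], and only the highest point in the order
    [rk i] completes it. Adding the last slack element would leave no free facet, and [t0] would
    violate dominance. *)
Lemma card_completions_external Y (t0 : T) : points Y = set0 ->
  #|Y|.+1 = #|I| -> #|completions Y| = 1.
Proof.
move=> Y0 Y_card; have := card_free Y_card; rewrite Y0 cards0.
move=> /eqP/cards1P[i Di].
have YN s : inl s \in Y = false.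
  by have := in_set0 s; rewrite -Y0 inE.
have freeE j : (inr j \notin Y) = (j == i).
  by have := in_set1 j i; rewrite -Di inE.
have [x x_max] : exists x, forall t, rk i t <= rk i x.
  by case: (arg_maxnP (rk i) (isT : xpredT t0)) => x _ x_max; exists x => t; exact: x_max.
suff -> : completions Y = [set inl x] by rewrite cards1.
apply/setP => z; rewrite in_set1 inE; apply/andP/eqP => [[zY /dominantP z_dom]|->].
  case: z => [y|j] in zY z_dom *.
    congr inl; apply: (rk_inj (i := i)); apply/eqP; rewrite eqn_leq x_max//.
    have [j] := z_dom x; rewrite in_setU1 /= freeE => /eqP -> /(_ y).
    by rewrite in_setU1 eqxx; apply.
  have [k] := z_dom t0; rewrite in_setU1 negb_or freeE => /andP[/eqP kj /eqP ki].
  by move: zY; rewrite freeE => /eqP ji; case: kj; rewrite ki ji.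
split; first by rewrite YN.
apply/dominantP => t; exists i; first by rewrite in_setU1 /= freeE.
by move=> s; rewrite in_setU1 YN orbF => /eqP[->]; exact: x_max.
Qed.

(* Count modulo 2 the pairs of a dominant set of size [#|I|] and one of its
   facets coloured by all colours but [i0]: every such facet lies in two
   dominant sets, except the one consisting of slack elements. *)
Theorem scarf (c : T -> I) (t0 : T) : exists2 X, dominant X &
  forall i, inr i \notin X -> exists2 s, inl s \in X & c s = i.
Proof.
pose col (u : T + I) := match u with inl t => c t | inr i => i end.
pose i0 := c t0.
suff [X X_dom X_col] : exists2 X, dominant X & col @: X = setT.
  exists X => // i iX; have : i \in col @: X by rewrite X_col.
  by move=> /imsetP[[s|j] Xu ui]; [exists s|rewrite ui Xu in iX].
pose room X := (#|X| == #|I|) && dominant X.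
have [/existsP[X /andP[/andP[_ X_dom] /eqP X_col]]|] :=
  boolP [exists X, room X && (col @: X == setT)]; first by exists X.
rewrite negb_exists => /forallP no_room; exfalso.
pose door Y := [&& #|Y|.+1 == #|I|, dominant Y & col @: Y == [set~ i0]].
have count : \sum_(X | room X) #|almost_colourful_facets col i0 X| =
    \sum_(Y | door Y) #|completions Y|.
  under eq_bigr do rewrite -sum1_card.
  under [RHS]eq_bigr do rewrite -sum1_card.
  rewrite !pair_big_dep /=.
  rewrite (reindex_onto (fun p => (p.2 |: p.1, p.2)) (fun p => (p.1 :\ p.2, p.2))) /=.
    apply: eq_bigl => -[Y z] /=; rewrite /door /room !inE eqxx /= xpair_eqE eqxx andbT.
    have [zY|zY] := boolP (z \in Y).
      rewrite /= andbF; apply/negbTE/negP => /andP[_ /eqP YE].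
      by move: zY; rewrite -YE !inE eqxx.
    rewrite setU1K// eqxx andbT cardsU1 zY add1n /=.
    apply/idP/idP => [/andP[/andP[-> zY_dom] ->]|].
      by rewrite zY_dom (dominant_sub _ zY_dom)// subsetUr.
    by move=> /andP[/and3P[-> _ ->] ->].
  move=> [X y] /=; rewrite inE => /andP[_ /andP[Xy _]].
  by rewrite setD1K.
have : ~~ odd (\sum_(X | room X) #|almost_colourful_facets col i0 X|).
  apply: even_sum => X room_X; apply: even_almost_colourful_facets.
    by have /andP[/eqP] := room_X.
  by have := no_room X; rewrite room_X.
pose Y0 : {set T + I} := inr @: [set~ i0].
have inr_inj : injective (@inr T I) by move=> ? ? [].
have Y0T s : (inl s \in Y0) = false by apply/negbTE/negP => /imsetP[].
have door0 : door Y0.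
  apply/and3P; split.
  - by rewrite card_imset// cardsC1 prednK//; apply/card_gt0P; exists i0.
  - apply/dominantP => t; exists i0; last by move=> s; rewrite Y0T.
    by rewrite mem_imset// !inE eqxx.
  - by rewrite -imset_comp; apply/eqP; exact: imset_id.
rewrite count (bigD1 Y0)//= oddD card_completions_external//; last first.
- by have /and3P[/eqP] := door0.
- by apply/setP => s; rewrite !inE Y0T.
rewrite /= negbK; apply/negP; apply: even_sum => Y /andP[door_Y YY0].
have /and3P[/eqP Y_card Y_dom /eqP Y_col] := door_Y.
(* Slack elements are coloured by themselves, so a door without points is [Y0]; any other door is
   internal and has two completions. *)
have [Y_pts|/set0Pn[s0]] := eqVneq (points Y) set0.
  case/eqP: YY0; apply/setP => -[s|i].
    by rewrite Y0T; have := in_set0 s; rewrite -Y_pts inE.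
  rewrite mem_imset//; rewrite -Y_col; apply/idP/imsetP => [Yi|[[s|j] Yu ->]] //.
    by exists (inr i).
  by have := in_set0 s; rewrite -Y_pts inE Yu.
rewrite inE => Ys0.
pose m i := [arg min_(t < s0 | inl t \in Y) rk i t].
have mP i : inl (m i) \in Y /\ forall s, inl s \in Y -> rk i (m i) <= rk i s.
  by rewrite /m; case: arg_minnP.
by rewrite (card_completions_internal Y_card Y_dom (fun i => (mP i).1)
  (fun i => (mP i).2)).
Qed.

End scarf.

(** * The covering lemma on the grid points of a simplex *)

Section simplex_grid.
Variables (I : finType) (N : nat).

Definition grid := {x : {ffun I -> 'I_N.+1} | \sum_i (x i : nat) == N}.

Definition grid_coord (t : grid) (i : I) : nat := val t i.

Lemma sum_coord t : \sum_i grid_coord t i = N.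
Proof. exact/eqP/(valP t). Qed.

Lemma exists_coord (F : I -> nat) : \sum_i F i = N ->
  exists t : grid, forall i, grid_coord t i = F i.
Proof.
move=> F_sum; have F_lt i : F i < N.+1.
  by rewrite ltnS -F_sum (bigD1 i)//= leq_addr.
pose x := [ffun i => Ordinal (F_lt i)].
have x_sum : \sum_i (x i : nat) == N.
  by rewrite -[X in _ == X]F_sum; apply/eqP/eq_bigr => i _; rewrite ffunE.
by exists (Sub x x_sum) => i; rewrite /grid_coord SubK ffunE.
Qed.

(** The orders must be injective: equal coordinates are separated by the enumeration of the grid,
    whose size as a factor preserves the order of the coordinates. *)
Let height (i : I) (t : grid) := grid_coord t i * #|{: grid}| + enum_rank t.

Let height_inj i : injective (height i).
Proof.
move=> s t st; apply/enum_rank_inj/val_inj => /=.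
have := congr1 (modn^~ #|{: grid}|) st.
by rewrite !modnMDl !modn_small ?ltn_ord.
Qed.

Let height_le i s t : height i s <= height i t -> grid_coord s i <= grid_coord t i.
Proof.
apply: contraTT; rewrite -!ltnNge /height => ts.
apply: leq_trans (leq_addr _ _); apply: leq_trans (leq_mul ts (leqnn _)).
by rewrite mulSn addnC -addSn leq_add2r ltn_ord.
Qed.

(** No boundary condition is put on the labels: a label may be missing from [F], but then its
    coordinate is small on [F]. The bounds hold because the lowest coordinates of the dominant set
    sum over [C] to more than [N - #|C|], whereas the coordinates of a point sum to [N]: less than
    [#|C|] is left to share. *)
Lemma knaster_kuratowski_mazurkiewicz_grid (c : grid -> I) : 0 < #|I| ->
  exists (F : {set grid}) (C : {set I}), [/\ C != set0,
    forall i, i \in C -> exists2 s, s \in F & c s = i,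
    forall s i, s \in F -> i \notin C -> grid_coord s i <= #|I| &
    forall s t i, s \in F -> t \in F -> grid_coord s i <= grid_coord t i + #|I|].
Proof.
move=> /card_gt0P[i0 _].
have [t0 _] : exists t : grid, forall i, grid_coord t i = if i == i0 then N else 0.
  by apply: exists_coord; rewrite -big_mkcond big_pred1_eq.
have [X /dominantP X_dom X_col] := scarf height_inj c t0.
pose F := points X; pose C := free_facets X.
have CP i : (i \in C) = (inr i \notin X) by rewrite inE.
have FP s : (s \in F) = (inl s \in X) by rewrite inE.
have [i1 i1X _] := X_dom t0.
have [s1 s1X _] := X_col i1 i1X.
pose m i := [arg min_(t < s1 | inl t \in X) grid_coord t i].
have mP i : inl (m i) \in X /\
    forall s, inl s \in X -> grid_coord (m i) i <= grid_coord s i.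
  by rewrite /m; case: arg_minnP.
(* Otherwise raising each lowest coordinate by one would give a grid point
   contradicting the dominance of [X]. *)
have C_sum : N < \sum_(i in C) (grid_coord (m i) i).+1.
  rewrite ltnNge; apply/negP => C_le.
  pose rest := N - \sum_(i in C) (grid_coord (m i) i).+1.
  have [t tE] : exists t : grid, forall i, grid_coord t i =
      (if i \in C then (grid_coord (m i) i).+1 else 0) + (if i == i1 then rest else 0).
    apply: exists_coord; rewrite big_split /= -!big_mkcond big_pred1_eq.
    by rewrite subnKC.
  have [i iX ti] := X_dom t.
  have := height_le (ti _ (mP i).1); rewrite tE CP iX; lia.
have C_card : #|C| <= #|I| by exact: max_card.
have C_split s : inl s \in X ->
    \sum_(i in C) grid_coord (m i) i <= \sum_(i in C) grid_coord s i.
  by move=> Xs; apply: leq_sum => i _; apply: (mP i).2.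
have C_sumE : \sum_(i in C) (grid_coord (m i) i).+1 =
    \sum_(i in C) grid_coord (m i) i + #|C|.
  under eq_bigr do rewrite -addn1.
  by rewrite big_split /= sum1_card.
have sum_split s :
    \sum_(i in C) grid_coord s i + \sum_(i | i \notin C) grid_coord s i = N.
  by rewrite -[RHS](sum_coord s) [RHS](bigID (mem C)).
have out s i : inl s \in X -> i \notin C -> grid_coord s i <= #|C|.
  move=> Xs Ci; have := C_split s Xs; have := sum_split s.
  rewrite [X in _ + X](bigD1 i)//=; rewrite C_sumE in C_sum.
  move: (\sum_(_ in C) grid_coord s _) (\sum_(_ in C) _) C_sum => *; lia.
have inside s i : inl s \in X -> i \in C -> grid_coord s i <= grid_coord (m i) i + #|C|.
  move=> Xs Ci; have := sum_split s; rewrite C_sumE in C_sum.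
  have : \sum_(j in C | j != i) grid_coord (m j) j <=
      \sum_(j in C | j != i) grid_coord s j.
    by apply: leq_sum => j _; apply: (mP j).2.
  rewrite (bigD1 i Ci) /= in C_sum; rewrite (bigD1 i Ci) /=.
  move: (\sum_(_ in C | _) grid_coord s _) (\sum_(_ in C | _) _) C_sum => *; lia.
exists F, C; split.
- by apply/set0Pn; exists i1; rewrite CP.
- by move=> i; rewrite CP => /X_col[s Xs cs]; exists s; rewrite ?FP.
- by move=> s i; rewrite FP => Xs Ci; exact: leq_trans (out s i Xs Ci) C_card.
move=> s t i; rewrite !FP => Xs Xt; have [Ci|Ci] := boolP (i \in C).
  by apply: leq_trans (inside s i Xs Ci) (leq_add ((mP i).2 t Xt) C_card).
by apply: leq_trans (leq_trans (out s i Xs Ci) C_card) (leq_addl _ _).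
Qed.

End simplex_grid.

From mathcomp Require Import all_order all_algebra.
From mathcomp Require Import all_classical all_reals all_analysis.
From mathcomp Require Import ring lra.

Import Order.TTheory GRing.Theory Num.Theory.
Import numFieldNormedType.Exports.

Local Open Scope classical_set_scope.
Local Open Scope ring_scope.

(** * Hahn-Banach *)

Section hahn_banach.
Context {R : realType} {V : lmodType R}.
Implicit Types (p q : V -> R) (x y : V).

Definition sublinear q :=
  (forall x y, q (x + y) <= q x + q y) /\
  (forall t x, 0 <= t -> q (t *: x) <= t * q x).

Lemma inf_sublinear (S : V -> set R) :
  (forall x, has_inf (S x)) ->
  (forall x y a b, S x a -> S y b -> exists2 c, S (x + y) c & c <= a + b) ->
  (forall t x a, 0 <= t -> S x a -> exists2 c, S (t *: x) c & c <= t * a) ->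
  sublinear (fun x => inf (S x)).
Proof.
move=> S_inf SD SZ; split=> [x y|t x].
  rewrite -lerBlDr; apply: lb_le_inf; first by case: (S_inf x).
  move=> a Sa; rewrite lerBlDr -lerBlDl.
  apply: lb_le_inf; first by case: (S_inf y).
  move=> b Sb; rewrite lerBlDl; have [c Sc cab] := SD _ _ _ _ Sa Sb.
  by rewrite (le_trans _ cab)// ge_inf//; case: (S_inf (x + y)).
have [[a Sa] _] := S_inf x.
rewrite le_eqVlt => /predU1P[<-|t0].
  have [c Sc c0] := SZ 0 x a (lexx _) Sa.
  rewrite mul0r in c0; rewrite mul0r; apply: le_trans c0.
  by apply: ge_inf => //; case: (S_inf (0 *: x)).
rewrite -ler_pdivrMl//; apply: lb_le_inf; first by exists a.
move=> b Sb; rewrite ler_pdivrMl//.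
have [c Sc cb] := SZ t x b (ltW t0) Sb.
by rewrite (le_trans _ cb)// ge_inf//; case: (S_inf (t *: x)).
Qed.

Section sublinear_theory.
Variables (q : V -> R) (q_sub : sublinear q).

Lemma sublinear0 : q 0 = 0.
Proof.
have [qD qZ] := q_sub; apply/le_anti/andP; split.
  by have := qZ 0 0 (lexx _); rewrite scale0r mul0r.
by have := qD 0 0; rewrite addr0 -subr_ge0 addrK.
Qed.

Lemma sublinearN x : - q (- x) <= q x.
Proof.
have [qD _] := q_sub; have := qD x (- x).
by rewrite subrr sublinear0 -lerBlDr sub0r.
Qed.

Lemma sublinearZ t x : 0 <= t -> q (t *: x) = t * q x.
Proof.
have [_ qZ] := q_sub; rewrite le_eqVlt => /predU1P[<-|t0].
  by rewrite scale0r mul0r sublinear0.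
apply/le_anti; rewrite qZ ?(ltW t0)//= mulrC -ler_pdivlMr// mulrC.
have := qZ t^-1 (t *: x); rewrite scalerA mulVf ?gt_eqF// scale1r; apply.
by rewrite invr_ge0 ltW.
Qed.

End sublinear_theory.

(** The infimum over [t >= 0] of [q (x + t *: v) - t * q v] is sublinear and at most [q], so by
    minimality it is [q]; its value at [- v] is at most [- q v], as [t = 1] shows. *)
Lemma minimal_sublinear_odd q : sublinear q ->
  (forall q', sublinear q' -> (forall x, q' x <= q x) ->
     forall x, q x <= q' x) ->
  forall x, q (- x) = - q x.
Proof.
move=> q_sub q_min v; have [qD qZ] := q_sub.
pose S x := [set q (x + t *: v) - t * q v | t in [set t | 0 <= t]].
have S_inf x : has_inf (S x).
  split; first by exists (q (x + 0 *: v) - 0 * q v), 0; rewrite /= ?lexx.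
  exists (- q (- x)) => _ [t /= t0 <-].
  have := qD (x + t *: v) (- x); rewrite addrAC subrr add0r sublinearZ//.
  lra.
have Sq : sublinear (fun x => inf (S x)).
  apply: inf_sublinear => //.
    move=> x y _ _ [s /= s0 <-] [t /= t0 <-].
    exists (q (x + y + (s + t) *: v) - (s + t) * q v).
      by exists (s + t) => //=; rewrite addr_ge0.
    have := qD (x + s *: v) (y + t *: v); rewrite addrACA -scalerDl.
    by move=> h; rewrite mulrDl; lra.
  move=> r x _ r0 [t /= t0 <-].
  exists (q (r *: x + (r * t) *: v) - r * t * q v).
    by exists (r * t) => //=; rewrite mulr_ge0.
  by rewrite -scalerA -scalerDr mulrBr mulrA lerD2r qZ.
have Sle x : inf (S x) <= q x.
  apply: ge_inf; first by case: (S_inf x).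
  by exists 0 => //=; rewrite scale0r mul0r addr0 subr0.
apply/le_anti; rewrite lerNl sublinearN// andbT.
apply: (le_trans (q_min _ Sq Sle (- v))).
apply: ge_inf; first by case: (S_inf (- v)).
by exists 1 => /=; rewrite ?ler01// scale1r mul1r addNr sublinear0// sub0r.
Qed.

Lemma exists_minimal_sublinear p : sublinear p ->
  exists q, [/\ sublinear q, forall x, q x <= p x &
    forall q', sublinear q' -> (forall x, q' x <= q x) ->
      forall x, q x <= q' x].
Proof.
move=> p_sub.
pose T := {q | sublinear q /\ forall x, q x <= p x}.
(* The order is reversed, so that a maximal element for Zorn's lemma is a minimal functional. *)
pose Rel (s t : T) := `[< forall x, sval t x <= sval s x >].
have [|||m m_max] :=
    @ZL_preorder T (exist _ p (conj p_sub (fun=> lexx _))) Rel.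
- by move=> s; apply/asboolP.
- move=> r s t /asboolP rs /asboolP st; apply/asboolP => x.
  exact: le_trans (st x) (rs x).
- move=> A A_tot; have [[s0 As0]|A0] := pselect (A !=set0); last first.
    exists (exist _ p (conj p_sub (fun=> lexx _))) => s As.
    by exfalso; apply: A0; exists s.
  pose S x := [set sval s x | s in A].
  (* The infimum of a chain stays finite: each member is bounded below by [- p (- x)]. *)
  have S_inf x : has_inf (S x).
    split; first by exists (sval s0 x), s0.
    exists (- p (- x)) => _ [s As <-]; have [s_sub sp] := svalP s.
    by apply: le_trans (sublinearN s_sub x); rewrite lerN2.
  have S_sub : sublinear (fun x => inf (S x)).
    apply: inf_sublinear => //.
      move=> x y _ _ [s As <-] [t At <-].
      have [sD _] := (svalP s).1; have [tD _] := (svalP t).1.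
      case: (A_tot _ _ As At) => /asboolP st.
        exists (sval t (x + y)); first by exists t.
        by rewrite (le_trans (tD _ _))// lerD2r.
      exists (sval s (x + y)); first by exists s.
      by rewrite (le_trans (sD _ _))// lerD2l.
    move=> t x _ t0 [s As <-]; exists (sval s (t *: x)); first by exists s.
    by have [_] := (svalP s).1; apply.
  have S_le x : inf (S x) <= p x.
    apply: (@le_trans _ _ (sval s0 x)); last exact: (svalP s0).2.
    by apply: ge_inf; [case: (S_inf x)|exists s0].
  exists (exist _ (fun x => inf (S x)) (conj S_sub S_le) : T) => s As; apply/asboolP => x /=.
  by apply: ge_inf; [case: (S_inf x)|exists s].
exists (sval m); split=> [||q' q'_sub q'm]; first by have [] := svalP m.
  by have [] := svalP m.
have q'p x : q' x <= p x by apply: le_trans (q'm x) _; exact: (svalP m).2.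
have /asboolP qq' := m_max (exist _ q' (conj q'_sub q'p)) (asboolT q'm).
exact: qq'.
Qed.

(** An odd subadditive function is additive, so a minimal sublinear functional below [p] is
    linear. *)
Lemma hahn_banach p : sublinear p ->
  exists f : {linear V -> R^o}, forall x, f x <= p x.
Proof.
move=> /exists_minimal_sublinear[q [q_sub qp q_min]].
have qN := minimal_sublinear_odd q_sub q_min.
have [qD _] := q_sub.
have q_add x y : q (x + y) = q x + q y.
  apply/le_anti; rewrite qD /=.
  have := qD (x + y) (- y); rewrite addrK qN; lra.
have q_lin : linear (q : V -> R^o).
  move=> a x y; rewrite q_add; congr (_ + _).
  have [a0|a0] := leP 0 a; first by rewrite sublinearZ.
  have : q (- (- a *: x)) = - (- a * q x).
    by rewrite qN sublinearZ // oppr_ge0 ltW.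
  by rewrite scaleNr mulNr !opprK.
pose f : {linear V -> R^o} :=
  HB.pack (q : V -> R^o) (GRing.isLinear.Build _ _ _ _ _ q_lin).
by exists f.
Qed.

End hahn_banach.

(** * Separation *)

Section separation.
Context {R : realType} {E : normedModType R}.
Implicit Types (x y : E) (C : set E) (f : {linear E -> R^o}).

Lemma convex_setP C : convex_set C <->
  forall x y (t : R), C x -> C y -> 0 <= t -> t <= 1 ->
    C (t *: x + (1 - t) *: y).
Proof.
split=> [C_cvx x y t Cx Cy t0 t1|C_cvx x y t /set_mem Cx /set_mem Cy].
  have := C_cvx x y (Itv01 t0 t1) (mem_set Cx) (mem_set Cy).
  by move=> /set_mem.
by apply/mem_set; apply: C_cvx.
Qed.

Definition contractive f := forall x, `|f x : R| <= `|x|.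

(* Subtraction in [R], rather than in its regular module [R^o]. *)
Lemma functionalB f x y : f (x - y) = (f x : R) - (f y : R).
Proof. exact: linearB. Qed.

Lemma functionalP f (a b : R) x y :
  f (a *: x + b *: y) = a * (f x : R) + b * (f y : R).
Proof. by rewrite linearD !linearZ. Qed.

Lemma contractive_continuous f : contractive f -> continuous f.
Proof.
move=> f1; apply: bounded_linear_continuous; apply/linear_boundedP.
exists 1; split; first exact: num_real.
by move=> M M1 x; rewrite (le_trans (f1 x))// ler_peMl// ltW.
Qed.

Lemma continuous_linear_bound f : continuous f ->
  exists2 M : R, 0 < M & forall x, `|f x : R| <= M * `|x|.
Proof.
move=> f_cont; have : bounded_near f (nbhs (0 : E)).
  exact/linear_bounded_continuous.
by move=> /linear_boundedP /pinfty_ex_gt0[M M0 fM]; exists M.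
Qed.

Lemma contractive_scale f : continuous f ->
  exists2 M : R, 0 < M & exists2 g, contractive g & forall x, f x = M * g x.
Proof.
move=> /continuous_linear_bound[M M0 fM]; exists M => //.
have lin : linear ((fun x => M^-1 * f x) : E -> R^o).
  by move=> a x y; rewrite linearP /GRing.scale /=; ring.
pose g : {linear E -> R^o} :=
  HB.pack ((fun x => M^-1 * f x) : E -> R^o)
    (GRing.isLinear.Build _ _ _ _ _ lin).
exists g => x /=; last by rewrite mulrA divff ?mul1r// gt_eqF.
by rewrite normrM gtr0_norm ?invr_gt0// mulrC ler_pdivrMr// mulrC.
Qed.

Lemma contractive_opp f : contractive f ->
  exists2 g, contractive g & forall x, g x = - f x.
Proof.
move=> f1; have lin : linear ((fun x => - f x) : E -> R^o).
  by move=> a u v; rewrite linearP /GRing.scale /=; ring.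
pose g : {linear E -> R^o} :=
  HB.pack ((fun x => - f x) : E -> R^o) (GRing.isLinear.Build _ _ _ _ _ lin).
by exists g => // x; rewrite normrN.
Qed.

(* The functional is dominated by the gauge
   [v |-> inf (|v - t c| - t r)], with [t >= 0] and [c] in [C]. *)
Lemma separation C (r : R) : C !=set0 -> convex_set C ->
  (forall x, C x -> r <= `|x|) ->
  exists2 f, contractive f & forall x, C x -> f x <= - r.
Proof.
move=> [c0 Cc0] /convex_setP C_cvx Cr.
pose S x := [set a | exists t c, [/\ 0 <= t, C c & a = `|x - t *: c| - t * r]].
have S_norm x : S x `|x|.
  by exists 0, c0; rewrite lexx scale0r mul0r !subr0.
have S_lb x : has_lbound (S x).
  exists (- `|x|) => _ [t [c [t0 Cc ->]]].
  have tc : t * r <= `|t *: c|.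
    by rewrite normrZ ger0_norm// ler_wpM2l// Cr.
  have := ler_normB x (x - t *: c); rewrite opprB addrC subrK => h; lra.
have [f fS] : exists f : {linear E -> R^o}, forall x, f x <= inf (S x).
  apply: hahn_banach; apply: inf_sublinear.
  - by move=> x; split => //; exists `|x|.
  - move=> x y _ _ [s [c [s0 Cc ->]]] [t [d [t0 Cd ->]]].
    have [st0|st0] := eqVneq (s + t) 0.
      exists `|x + y|; first exact: S_norm.
      have -> : s = 0 by lra.
      have -> : t = 0 by lra.
      by rewrite !scale0r !mul0r !subr0 ler_normD.
    pose u := s / (s + t).
    have u1 : 1 - u = t / (s + t) by rewrite /u; field.
    exists (`|x + y - (s + t) *: (u *: c + (1 - u) *: d)| - (s + t) * r).
      exists (s + t), (u *: c + (1 - u) *: d).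
      split => //; first exact: addr_ge0.
      apply: C_cvx => //; first by rewrite divr_ge0// addr_ge0.
      by rewrite -subr_ge0 u1 divr_ge0// addr_ge0.
    rewrite u1 scalerDr !scalerA !(mulrC (s + t)) !divfK//.
    have -> : x + y - (s *: c + t *: d) = (x - s *: c) + (y - t *: d).
      by rewrite opprD addrACA.
    have := ler_normD (x - s *: c) (y - t *: d); rewrite mulrDr (mulrC r).
    by rewrite (mulrC r t) => h; lra.
  - move=> a x _ a0 [t [c [t0 Cc ->]]].
    exists (`|a *: x - (a * t) *: c| - a * t * r).
      by exists (a * t), c; rewrite mulr_ge0.
    by rewrite -scalerA -scalerBr normrZ ger0_norm// mulrBr mulrA.
have fle x : f x <= `|x| by rewrite (le_trans (fS x))// ge_inf.
exists f => x; last first.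
  move=> Cx; apply: le_trans (fS x) _; apply: ge_inf => //.
  by exists 1, x; rewrite ler01 scale1r subrr normr0 mul1r sub0r.
rewrite ler_norml fle andbT lerNl.
by have := fle (- x); rewrite linearN normrN.
Qed.

Lemma norming x : exists2 f, contractive f & f x = `|x|.
Proof.
have [||_ ->|f f1 fx] := @separation [set x] `|x|.
- by exists x.
- by apply/convex_setP => _ _ t -> -> _ _ /=; rewrite -scalerDl addrC subrK scale1r.
- exact: lexx.
have [g g1 gE] := contractive_opp f1; exists g => //.
apply/le_anti/andP; split; last by rewrite gE lerNr fx.
by rewrite (le_trans (ler_norm _)).
Qed.

Lemma contractive_eq x y :
  (forall f, contractive f -> f x = f y) -> x = y.
Proof.
move=> fxy; have [f f1 fE] := norming (x - y); apply/eqP.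
by rewrite -subr_eq0 -normr_eq0 -fE linearB fxy// subrr.
Qed.

End separation.

(** * Weak topology *)

Section ultrafilter_limits.
Context {R : realType}.

Lemma ultra_fmap (T T' : Type) (h : T -> T') (U : set_system T) :
  UltraFilter U -> UltraFilter (h @ U).
Proof.
move=> U_ultra; split; first exact: fmap_proper_filter.
move=> G G_proper hUG; apply/seteqP; split=> // A GA.
have [//|UA] := in_ultra_setVsetC (h @^-1` A) U_ultra.
have GAc : G (~` A) by apply: hUG.
by have /filter_ex[y []] : G (A `&` ~` A) by exact: filterI.
Qed.

Section ulim.
Context {T : Type} (U : set_system T) {U_ultra : UltraFilter U}.
Implicit Types (g h : T -> R).

Definition bounded_along h := exists M, U [set x | `|h x| <= M].

Definition ulim h : R := lim (h @ U).

Lemma ulimP h : bounded_along h -> h @ U --> ulim h.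
Proof.
move=> [M UM]; suff [l hl] : exists l : R, h @ U --> l.
  by apply/cvg_ex; exists l.
have := @segment_compact R (- M) M; rewrite compact_ultra.
have hU : (h @ U) `[- M, M]%classic.
  rewrite fmapE; apply: (@filterS _ U _ _ _ _ UM) => x /=.
  by rewrite in_itv /= ler_norml.
by move=> /(_ _ (ultra_fmap h U_ultra) hU)[l [_ hl]]; exists l.
Qed.

Lemma bounded_along_sum g h a b : bounded_along g -> bounded_along h ->
  bounded_along (fun x => a * g x + b * h x).
Proof.
move=> [M gM] [N hN]; exists (`|a| * M + `|b| * N).
apply: filterS2 gM hN => x /= gM hN.
by rewrite (le_trans (ler_normD _ _))// !normrM lerD// ler_wpM2l.
Qed.

Lemma ulim_sum g h a b : bounded_along g -> bounded_along h ->
  ulim (fun x => a * g x + b * h x) = a * ulim g + b * ulim h.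
Proof.
move=> g_bd h_bd; apply: cvg_lim => //.
by apply: cvgD; apply: cvgMl_tmp; exact: ulimP.
Qed.

Lemma ulim_cst a : ulim (fun=> a) = a.
Proof. by apply: cvg_lim => //; exact: cvg_cst. Qed.

Lemma ulim_cvg h (l : R) : h @ U --> l -> ulim h = l.
Proof. exact: cvg_lim. Qed.

Lemma ulim_le g h : bounded_along g -> bounded_along h ->
  U [set x | g x <= h x] -> ulim g <= ulim h.
Proof.
move=> /ulimP gl /ulimP hl gh; rewrite -subr_ge0.
apply: (cvgr_to_ge (cvgB hl gl)).
by apply: filterS gh => x /=; rewrite subr_ge0.
Qed.

Lemma ulim_dist_le h a M :
  U [set x | `|h x - a| <= M] -> `|ulim h - a| <= M.
Proof.
move=> hM; have h_bd : bounded_along h.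
  exists (M + `|a|); apply: filterS hM => x /=.
  by rewrite -lerBlDr; apply: le_trans; exact: lerB_dist.
by apply: (cvgr_to_le (cvg_norm (cvgB (ulimP h_bd) (cvg_cst a)))).
Qed.

End ulim.
End ultrafilter_limits.

Section weak_topology.
Context {R : realType} {E : normedModType R}.
Implicit Types (x y : E) (C K : set E) (f : {linear E -> R^o}).
Implicit Types F : set_system E.
Local Notation wE := (weak_space E).

Lemma initial_cvgP (T : choiceType) (T' : topologicalType) (h : T -> T')
    (F : set_system T) (x : T) : Filter F ->
  F --> (x : initial_topology h) <-> h @ F --> h x.
Proof.
move=> FF; split=> [Fx|hF].
  by apply: cvg_trans (@initial_continuous T T' h x); apply: cvg_fmap2.
move=> A /= [_ [[B B_open <-] Bhx BA]].
by apply: (filterS BA); apply: hF; exact: open_nbhs_nbhs.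
Qed.

Lemma weak_cvgP F x : Filter F ->
  (F : set_system wE) --> (x : wE) <->
  forall f, contractive f -> (f : E -> R^o) @ F --> (f x : R^o).
Proof.
move=> FF; split=> [/cvg_sup Fx f f1|Fx].
  have := Fx (exist _ f (contractive_continuous f1)).
  by move=> /initial_cvgP; apply.
apply/cvg_sup => -[f f_cont]; apply/initial_cvgP => /=.
have [M M0 [g g1 fE]] := contractive_scale f_cont.
rewrite (_ : (f : E -> R^o) = (fun y => M * g y)); last exact/funext.
by apply: (@cvgMl_tmp R); exact: Fx.
Qed.

Lemma contractive_weak_continuous f : contractive f ->
  continuous (f : wE -> R^o).
Proof.
move=> f1 x.
by have /weak_cvgP := @cvg_id _ (nbhs (x : wE)); apply.
Qed.

Lemma closed_convex_separation C x : C !=set0 -> closed C -> convex_set C ->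
  ~ C x -> exists2 f, contractive f &
    exists2 r : R, 0 < r & forall y, C y -> f y <= f x - r.
Proof.
move=> [c Cc] C_closed /convex_setP C_cvx Cx.
have [r r0 rC] : exists2 r : R, 0 < r & forall y, C y -> r <= `|y - x|.
  have : nbhs x (~` C) by apply: open_nbhs_nbhs; split => //; exact: closed_openC.
  move=> /nbhs_ballP[r r0 rC]; exists r => // y Cy; rewrite leNgt; apply/negP.
  by rewrite distrC => xy; apply: (rC y) => //; rewrite -ball_normE.
have [|||f f1 fr] := @separation R E [set y - x | y in C] r.
- by exists (c - x), c.
- apply/convex_setP => _ _ t [y Cy <-] [z Cz <-] t0 t1.
  exists (t *: y + (1 - t) *: z); first exact: C_cvx.
  rewrite !scalerBr addrACA -opprD -scalerDl.
  by rewrite (addrC t) subrK scale1r.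
- by move=> _ [y Cy <-]; exact: rC.
exists f => //; exists r => // y Cy.
have /fr : [set y - x | y in C] (y - x) by exists y.
by rewrite linearB lerBlDr addrC.
Qed.

(** A point outside [C] has a separating functional, and a half-space around the point is a weak
    neighbourhood that misses [C]. *)
Lemma mazur C : closed C -> convex_set C -> @closed wE C.
Proof.
move=> C_closed C_cvx x Cx; apply: contrapT => nCx.
have C0 : C !=set0 by have [y []] := Cx setT filterT; exists y.
have [f f1 [r r0 fr]] := closed_convex_separation C0 C_closed C_cvx nCx.
have : nbhs (f x) [set y : R^o | `|f x - y| < r].
  by apply/nbhs_ballP; exists r => //= y; rewrite -ball_normE.
move=> /(contractive_weak_continuous f1)/Cx[y [/fr fy /=]].
by rewrite ltr_norml; lra.
Qed.

Lemma weakly_compactP K : weakly_compact K <->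
  forall U : set_system E, UltraFilter U -> U K ->
    exists2 x, K x & (U : set_system wE) --> (x : wE).
Proof.
rewrite /weakly_compact compact_ultra; split=> K_cpt U U_ultra UK.
  by have [x []] := K_cpt U U_ultra UK; exists x.
by have [x Kx Ux] := K_cpt U U_ultra UK; exists x.
Qed.

End weak_topology.

(** If a neighbourhood [A] of [x] were not in [F], the trace of [F] on the complement of [A] would
    be proper and cluster in [K] at a point that cannot be [x]. *)
Lemma compact_cvg_unique (T : topologicalType) (K : set T)
    (F : set_system T) (x : T) : ProperFilter F -> compact K -> F K ->
  (forall y, K y -> cluster F y -> y = x) -> F --> x.
Proof.
move=> F_proper K_cpt FK Fx A xA; apply: contrapT => FA.
have G_proper : ProperFilter (within (~` A) F).
  split; last exact: within_filter.
  by rewrite /within /= => FA'; apply: FA; apply: filterS FA' => y; exact: contrapT.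
have [|y [Ky Fy]] := K_cpt (within (~` A) F).
  by apply: filterS FK.
have Gy : cluster F y by apply: cvg_cluster Fy; exact: cvg_within.
have xy := Fx _ Ky Gy; rewrite xy in Fy.
have [||z []//] := Fy (~` A) A => //.
by rewrite /within /=; apply: filterE.
Qed.

(** * Midpoint hulls and separating functionals *)

Lemma countableU (T : Type) (X Y : set T) :
  countable X -> countable Y -> countable (X `|` Y).
Proof.
move=> X_countable Y_countable.
have -> : X `|` Y = \bigcup_b (if b then X else Y).
  apply/seteqP; split=> [x [Xx|Yx]|x [[] _ ?]]; [|by exists false|by left|by right].
  by exists true.
by apply: bigcup_countable => // -[].
Qed.

Section countable_hulls.
Context {R : realType} {E : normedModType R}.
Implicit Types (x y : E) (X Y : set E) (f : E -> E).

Definition midpoint x y : E := 2^-1 *: (x + y).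

(** Midpoints suffice for a convex closure and, unlike arbitrary convex combinations, keep the hull
    of a countable set countable. With [id] for [f] this is the plain midpoint hull. *)
Inductive midpoint_hull f X : set E :=
| Hull_base x : X x -> midpoint_hull f X x
| Hull_map x : midpoint_hull f X x -> midpoint_hull f X (f x)
| Hull_mid x y : midpoint_hull f X x -> midpoint_hull f X y ->
    midpoint_hull f X (midpoint x y).

Lemma midpoint_hull_countable f X :
  countable X -> countable (midpoint_hull f X).
Proof.
move=> X_countable.
pose C := fix C n := if n is n'.+1 then
  C n' `|` f @` C n' `|` (fun p => midpoint p.1 p.2) @` (C n' `*` C n') else X.
have CS n : C n `<=` C n.+1 by move=> x Cx; left; left.
have C_le m n : (m <= n)%N -> C m `<=` C n.
  move=> /subnK <-; elim: (n - m)%N => // k IH x /IH; exact: CS.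
have C_countable n : countable (C n).
  elim: n => // n IH; apply: countableU; first apply: countableU => //.
    exact: sub_countable (card_image_le _ _) IH.
  exact: sub_countable (card_image_le _ _) (countableX IH IH).
apply: (@sub_countable _ _ _ (\bigcup_n C n)).
  apply: subset_card_le => x; elim=> {x} [x Xx|x _ [n _ Cx]|x y _ [m _ Cx] _ [n _ Cy]].
  - by exists 0.
  - by exists n.+1 => //; left; right; exists x.
  - exists (maxn m n).+1 => //; right; exists (x, y) => //.
    by split; [exact: C_le (leq_maxl m n) _ Cx|exact: C_le (leq_maxr m n) _ Cy].
exact: bigcup_countable.
Qed.

Lemma countable_enumeration X : countable X -> X !=set0 ->
  exists2 e : nat -> E, forall n, X (e n) & X `<=` range e.
Proof.
move=> /pcard_surjP[g gX] [x0 Xx0].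
exists (fun n => if pselect (X (g n)) then g n else x0) => [n|x Xx].
  by case: pselect.
have [n _ gn] := gX x Xx; exists n => //.
by case: pselect => //; rewrite gn.
Qed.

Lemma closure_normP X x : closure X x <->
  forall e : R, 0 < e -> exists2 y, X y & `|x - y| < e.
Proof.
split=> [Xx e e0|Xx A /nbhs_ballP[e e0 xA]].
  have [y [Xy xy]] := Xx _ (nbhsx_ballx x e e0).
  by exists y => //; rewrite -ball_normE in xy.
have [y Xy xy] := Xx e e0; exists y; split => //.
by apply: xA; rewrite -ball_normE.
Qed.

Lemma exists_half_expn_lt (e : R) : 0 < e -> exists n : nat, 2^-1 ^+ n < e.
Proof.
move=> e0; pose n := (Num.truncn e^-1).+1; exists n.
rewrite exprVn invf_plt ?posrE ?exprn_gt0//.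
apply: lt_trans (truncnS_gt e^-1) _.
by rewrite -natrX ltr_nat ltn_expl.
Qed.

Lemma closure_midpoint_convex X :
  (forall x y, X x -> X y -> X (midpoint x y)) -> convex_set (closure X).
Proof.
move=> X_mid; apply/convex_setP => x y t Xx Xy t0 t1.
pose P (a : R) := closure X (a *: x + (1 - a) *: y).
have P_mid a b : P a -> P b -> P ((a + b) / 2).
  move=> /closure_normP Pa /closure_normP Pb; apply/closure_normP => e e0.
  have [u Xu au] := Pa _ e0; have [v Xv bv] := Pb _ e0.
  exists (midpoint u v); first exact: X_mid.
  have -> : (a + b) / 2 *: x + (1 - (a + b) / 2) *: y =
      2^-1 *: ((a *: x + (1 - a) *: y) + (b *: x + (1 - b) *: y)).
    rewrite addrACA -!scalerDl scalerDr !scalerA; congr (_ *: _ + _ *: _);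
    by field.
  rewrite -scalerBr normrZ gtr0_norm ?invr_gt0//.
  rewrite opprD addrACA.
  have := ler_normD (a *: x + (1 - a) *: y - u) (b *: x + (1 - b) *: y - v).
  by move=> h; lra.
(* Dyadic bisection: [P] is stable under midpoints, so admissible parameters enclose [t] as closely
   as desired. *)
have bisect n : exists a b, [/\ P a, P b, a <= t, t <= b & b - a = 2^-1 ^+ n].
  elim: n => [|n [a [b [Pa Pb at_ tb ab]]]].
    exists 0, 1; split => //; rewrite /P ?subr0 ?subrr ?expr0//.
      by rewrite scale0r scale1r add0r.
    by rewrite scale0r scale1r addr0.
  have [m|m] := leP t ((a + b) / 2).
    exists a, ((a + b) / 2); split => //; first exact: P_mid.
    by rewrite exprS -ab; field.
  exists ((a + b) / 2), b; split => //; [exact: P_mid|exact: ltW|].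
  by rewrite exprS -ab; field.
suff : closure (closure X) (t *: x + (1 - t) *: y).
  by rewrite -(closure_id _).1//; exact: closed_closure.
apply/closure_normP => e e0.
have M0 : 0 < `|x - y| + 1 by rewrite ltr_wpDl.
have [n ne] := exists_half_expn_lt (divr_gt0 e0 M0).
have [a [b [Pa _ at_ tb ab]]] := bisect n.
exists (a *: x + (1 - a) *: y) => //.
have -> : t *: x + (1 - t) *: y - (a *: x + (1 - a) *: y) = (t - a) *: (x - y).
  rewrite opprD addrACA -!scalerBl scalerBr -scaleNr; congr (_ + _ *: _); ring.
rewrite normrZ ger0_norm ?subr_ge0//.
have ta : t - a <= 2^-1 ^+ n by rewrite -ab lerD2r.
apply: (@le_lt_trans _ _ (2^-1 ^+ n * `|x - y|)); first by rewrite ler_wpM2r.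
rewrite ltr_pdivlMr// in ne; apply: le_lt_trans ne.
by rewrite ler_wpM2l ?exprn_ge0// lerDl.
Qed.

(** The functionals norm the differences of an enumeration [e] of [X]. If [x] and [y] differ, some
    [e i] and [e j] within [|x - y| / 4] of them are more than [|x - y| / 2] apart; a functional
    norming [e i - e j] and equal at [x] and [y] would make this distance smaller than
    [|x - y| / 2]. *)
Lemma separating_functionals X : countable X -> X !=set0 ->
  exists2 p : nat -> {linear E -> R^o}, forall n, contractive (p n) &
    forall x y, closure X x -> closure X y ->
      (forall n, p n x = p n y) -> x = y.
Proof.
move=> X_countable X0; have [e eX Xe] := countable_enumeration X_countable X0.
have /choice[q qP] (ij : nat * nat) : exists f : {linear E -> R^o},
    contractive f /\ f (e ij.1 - e ij.2) = `|e ij.1 - e ij.2|.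
  by have [f f1 fE] := norming (e ij.1 - e ij.2); exists f.
pose d n : nat * nat := odflt (0%N, 0%N) (unpickle n).
exists (fun n => q (d n)) => [n|x y /closure_normP Xx /closure_normP Xy xy].
  exact: (qP _).1.
apply/eqP; rewrite -subr_eq0 -normr_le0 leNgt; apply/negP => xy0.
have r0 : 0 < `|x - y| / 4 by rewrite divr_gt0.
have [_ /Xe[i _ <-] xi] := Xx _ r0; have [_ /Xe[j _ <-] yj] := Xy _ r0.
have := xy (pickle (i, j)); rewrite /d pickleK /=.
have [q1 /= qE] := qP (i, j); set f := q (i, j) in q1 qE * => fxy.
have fx : `|f (x - e i)| < `|x - y| / 4 by apply: le_lt_trans xi; exact: q1.
have fy : `|f (y - e j)| < `|x - y| / 4 by apply: le_lt_trans yj; exact: q1.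
have xy_le : `|x - y| <= `|x - e i| + `|e i - e j| + `|y - e j|.
  rewrite -(normrN (y - _)) opprB.
  have -> : x - y = (x - e i) + (e i - e j) + (e j - y).
    by rewrite !subrKA.
  by rewrite (le_trans (ler_normD _ _))// lerD2r ler_normD.
have fD : f (e i - e j) = f (y - e j) - f (x - e i).
  by rewrite !linearB fxy /=; ring.
have := ler_norm (f (y - e j) : R); have := ler_norm (- (f (x - e i)) : R).
rewrite normrN => h1 h2; rewrite qE in fD; lra.
Qed.

End countable_hulls.

(** * Weakly compact sets are sequentially compact and bounded *)

Lemma exists_subseq (P : nat -> nat -> Prop) :
  (forall N n, exists2 m, (N <= m)%N & P n m) ->
  exists2 k : nat -> nat, {homo k : m n / (m < n)%N} & forall n, P n (k n).
Proof.
move=> P_often.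
have /choice[g gP] (Nn : nat * nat) : exists m, (Nn.1 <= m)%N /\ P Nn.2 m.
  by have [m] := P_often Nn.1 Nn.2; exists m.
pose k := fix k n := if n is n'.+1 then g ((k n').+1, n) else g (0%N, 0%N).
exists k; last by case=> [|n]; [case: (gP (0%N, 0%N))|case: (gP ((k n).+1, n.+1))].
by apply: (homo_ltn ltn_trans) => n; have [] := gP ((k n).+1, n.+1).
Qed.

Lemma incr_ge (k : nat -> nat) : {homo k : m n / (m < n)%N} ->
  forall n, (n <= k n)%N.
Proof. by move=> k_incr; elim=> // n IH; exact: leq_ltn_trans IH (k_incr _ _ _). Qed.

Lemma incr_cvg (k : nat -> nat) : {homo k : m n / (m < n)%N} -> k @ \oo --> \oo.
Proof.
move=> /incr_ge k_ge A [N _ NA]; exists N => // n Nn.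
by apply: NA; exact: leq_trans Nn (k_ge n).
Qed.

Section eberlein_smulian.
Context {R : realType} {E : normedModType R}.
Implicit Types (x y : E) (K : set E) (u : nat -> E).
Local Notation wE := (weak_space E).

Lemma weakly_cvg_toP u x : weakly_cvg_to u x <->
  forall f : {linear E -> R^o}, contractive f ->
    (fun n => f (u n) : R) @ \oo --> (f x : R).
Proof. exact: (@weak_cvgP R E (u @ \oo) x _). Qed.

Lemma weakly_cvg_to_subseq u x (k : nat -> nat) :
  {homo k : m n / (m < n)%N} -> weakly_cvg_to u x -> weakly_cvg_to (u \o k) x.
Proof.
by move=> /incr_cvg k_oo ux A /ux uA; exact: (k_oo (u @^-1` A) uA).
Qed.

(** By compactness it is enough to identify the cluster points [y] of [u] in [K]: [p j y] is a
    cluster value of a sequence converging to [p j x], so no [p j] separates [y] from [x]. *)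
Lemma separated_weakly_cvg_to K (p : nat -> {linear E -> R^o}) u x :
  weakly_compact K -> (forall n, contractive (p n)) ->
  (forall y z, K y -> K z -> (forall n, p n y = p n z) -> y = z) ->
  (forall n, K (u n)) -> K x ->
  (forall j, (fun n => p j (u n) : R) @ \oo --> (p j x : R)) ->
  weakly_cvg_to u x.
Proof.
move=> K_cpt p1 p_sep Ku Kx pu.
apply: (@compact_cvg_unique wE K) => //.
  by exists 0%N => // n _; exact: Ku.
move=> y Ky uy; apply: p_sep => // j; apply: (@Rhausdorff R).
move=> A B yA xB.
have [||z [[n Bn nz] Az]] :=
  uy [set u n | n in [set n | B (p j (u n))]] (p j @^-1` A).
- have uB : \oo [set n | B (p j (u n))] := pu j B xB.
  by apply: (@filterS _ \oo _ _ _ _ uB) => n Bn; exists n.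
- exact: contractive_weak_continuous (p1 j) y A yA.
by exists (p j z); split => //; rewrite -nz.
Qed.

(** The closed midpoint hull of the sequence is separable and, by Mazur's theorem, weakly closed, so
    it contains a weak cluster point [x]. Countably many functionals separate its points, and [k n]
    makes the first [n + 1] of them close to their values at [x]. *)
Theorem weakly_compact_subseq K u : weakly_compact K -> (forall n, K (u n)) ->
  exists2 k, {homo k : m n / (m < n)%N} &
    exists2 x, K x & weakly_cvg_to (u \o k) x.
Proof.
move=> K_cpt Ku; pose X := midpoint_hull id (range u).
have X_countable : countable X.
  apply: midpoint_hull_countable.
  exact: sub_countable (card_image_le _ _) (countableP _).
have uX n : X (u n) by apply: Hull_base; exists n.
have X0 : X !=set0 by exists (u 0%N).
have X_closed : @closed wE (closure X).
  apply: mazur; first exact: closed_closure.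
  by apply: closure_midpoint_convex => x y; exact: Hull_mid.
have [p p1 p_sep] := separating_functionals X_countable X0.
have [x [Kx ux]] : K `&` cluster (u @ \oo : set_system wE) !=set0.
  by apply: K_cpt; exists 0%N => // n _; exact: Ku.
have Xx : closure X x.
  apply: X_closed => A xA; apply: ux => //; exists 0%N => // n _.
  exact: subset_closure.
have often N n : exists2 m, (N <= m)%N &
    forall j, (j <= n)%N -> `|p j x - p j (u m) : R| < n.+1%:R^-1.
  have near_x : nbhs (x : wE) [set y : wE |
      forall j, (j <= n)%N -> `|p j x - p j y : R| < n.+1%:R^-1].
    have near_j (j : 'I_n.+1) : \forall y \near (x : wE),
        `|p j x - p j y : R| < n.+1%:R^-1.
      have := @contractive_weak_continuous R E (p j) (p1 j) x.
      by move=> /(@cvgrPdist_lt _ R^o)/(_ n.+1%:R^-1); apply.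
    apply: filterS (filter_forall _ near_j) => y h j jn.
    exact: (h (Ordinal (jn : (j < n.+1)%N))).
  have [|_ [[m Nm <-] h]] := ux [set u m | m in [set m | (N <= m)%N]] _ _ near_x.
    by exists N => // m Nm; exists m.
  by exists m.
have [k k_incr kP] := exists_subseq often.
exists k => //; exists x => //.
apply: (@separated_weakly_cvg_to (K `&` closure X) p) => //.
- exact: compact_closedI.
- by move=> y z [_ Xy] [_ Xz]; exact: p_sep.
- by move=> n; split; [exact: Ku|exact: subset_closure (uX _)].
move=> j; apply/cvgrPdist_lt => e e0; near=> n.
have jn : (j <= n)%N by near: n; exact: nbhs_infty_ge.
apply: (lt_trans (kP n j jn)).
near: n; exact: (near_infty_natSinv_lt (PosNum e0)).
Unshelve. all: by end_near. Qed.

Fixpoint hump (u : nat -> E) (g : nat -> {linear E -> R^o}) n (x : E) : R :=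
  if n is n'.+1 then hump u g n' x +
    (if 0 <= hump u g n' (u n') then 1 else -1) * 3^-1 ^+ n' * g n' x
  else 0.

(* Sokal's gliding hump: the signs in [hump] make the partial sums of
   [\sum_k +- 3^-k g_k] at least [3^-k |u_k|] in absolute value at [u_k]. *)
Lemma weakly_bounded u : (forall f : {linear E -> R^o}, contractive f ->
    exists M : R, forall n, `|f (u n) : R| <= M) ->
  exists M : R, forall n, `|u n| <= M.
Proof.
move=> f_bd; apply: contrapT => u_unbd.
(* This growth outweighs the coefficients [3^-k] of the series and leaves a lower bound proportional
   to [k]. *)
have often k : exists n, k%:R * 3 ^+ k < `|u n|.
  apply: contrapT => nk; apply: u_unbd; exists (k%:R * 3 ^+ k) => n.
  by rewrite leNgt; apply/negP => un; apply: nk; exists n.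
have /choice[s sP] := often; pose v := u \o s.
have /choice[g gP] (k : nat) : exists f : {linear E -> R^o},
    contractive f /\ f (v k) = `|v k|.
  by have [f f1 fE] := norming (v k); exists f.
pose h := hump v g.
have sgn1 (b : bool) : `|(if b then 1 else -1) : R| = 1.
  by case: b; rewrite ?normrN normr1.
have h_lin n : linear (h n : E -> R^o).
  elim: n => [|n IH] a x y.
    by rewrite /h /= /GRing.scale /= mulr0 addr0.
  rewrite /h /= -/(h n) -/(h n) IH linearP /GRing.scale /=; ring.
have h_step n x : `|h n.+1 x - h n x| <= 3^-1 ^+ n * `|x|.
  rewrite /h /= addrC addKr !normrM sgn1 mul1r normrX.
  rewrite ger0_norm ?invr_ge0// ler_wpM2l ?exprn_ge0 ?invr_ge0//.
  exact: (gP n).1.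
have h_tail m n x : (m <= n)%N ->
    `|h n x - h m x| <= 3 / 2 * (3^-1 ^+ m - 3^-1 ^+ n) * `|x|.
  move=> /subnK <-; elim: (n - m)%N => [|k IH].
    by rewrite !subrr normr0 mulr0 mul0r.
  rewrite addSn.
  have := ler_normD (h (k + m).+1 x - h (k + m)%N x) (h (k + m)%N x - h m x).
  rewrite subrKA => /le_trans; apply.
  have := h_step (k + m)%N x; rewrite exprS; lra.
have h_bd n x : `|h n x| <= 3 / 2 * `|x|.
  have := h_tail 0%N n x (leq0n _); rewrite /h /= -/(h n) subr0.
  move=> /le_trans; apply; rewrite ler_wpM2r// ler_piMr// ?divr_ge0//.
  by rewrite expr0 gerBl exprn_ge0 ?invr_ge0.
have [U [U_ultra oo_U]] := @ultraFilterLemma nat \oo _.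
have h_along x : bounded_along U (fun n => h n x).
  by exists (3 / 2 * `|x|); apply: filterE => n; exact: h_bd.
(* The coefficients have sum [3 / 2], whence the factor that makes the functional contractive. *)
pose f x : R^o := 2 / 3 * ulim U (fun n => h n x).
have f_lin : linear f.
  move=> a x y; rewrite /f.
  under [in LHS]eq_fun do rewrite h_lin -[h _ y]mul1r.
  by rewrite ulim_sum// /GRing.scale /=; ring.
pose F : {linear E -> R^o} := HB.pack f (GRing.isLinear.Build _ _ _ _ _ f_lin).
have F1 : contractive F.
  move=> x; rewrite /= /f normrM.
  have : `|ulim U (fun n => h n x) - 0| <= 3 / 2 * `|x|.
    by apply: ulim_dist_le; apply: filterE => n /=; rewrite subr0.
  by rewrite subr0 ger0_norm// => ?; lra.
(* The tail takes away at most [3 / 2 * 3^-(k+1) * |v k|], half of the [3^-k * |v k|] reached after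
   the term [k]; the factor [2 / 3] leaves one third. *)
have F_big k : k%:R / 3 <= `|F (v k) : R|.
  have hk : 3^-1 ^+ k * `|v k| <= `|h k.+1 (v k)|.
    rewrite /h /= -/(h k) (gP k).2.
    have : 0 <= 3^-1 ^+ k * `|v k| by rewrite mulr_ge0// exprn_ge0// invr_ge0.
    by case: ifPn => [|/negP/negP]; rewrite -?ltNge => *;
      [rewrite ger0_norm|rewrite ler0_norm]; lra.
  have : `|ulim U (fun n => h n (v k)) - h k.+1 (v k)| <= 2^-1 * 3^-1 ^+ k * `|v k|.
    apply: ulim_dist_le; apply: oo_U; exists k.+1 => // n /= kn.
    apply: le_trans (h_tail _ _ _ kn) _; rewrite exprS ler_wpM2r//.
    have : 0 <= 3^-1 ^+ n :> R by rewrite exprn_ge0// invr_ge0.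
    lra.
  have vk : k%:R <= 3^-1 ^+ k * `|v k|.
    by rewrite exprVn ler_pdivlMl ?exprn_gt0// mulrC ltW.
  rewrite /= /f normrM ger0_norm//.
  have := lerB_dist (h k.+1 (v k)) (h k.+1 (v k) - ulim U (fun n => h n (v k))).
  rewrite subKr (distrC (h _ _) (ulim _ _)) => *; lra.
have [M FM] := f_bd F F1.
have := le_trans (F_big (Num.truncn (3 * M)).+1) (FM (s (Num.truncn (3 * M)).+1)).
have := truncnS_gt (3 * M); lra.
Qed.

Lemma weakly_cvg_bounded u x : weakly_cvg_to u x ->
  exists M : R, forall n, `|u n| <= M.
Proof.
move=> /weakly_cvg_toP ux; apply: weakly_bounded => f f1.
have : cvgn (fun n => f (u n) : R) by apply/cvg_ex; exists (f x); exact: ux.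
by move=> /cvg_seq_bounded /pinfty_ex_gt0[M _ fM]; exists M => n; exact: fM.
Qed.

Theorem weakly_compact_bounded K : weakly_compact K ->
  exists M : R, forall x, K x -> `|x| <= M.
Proof.
move=> K_cpt; apply: contrapT => K_unbd.
have /choice[u uP] (n : nat) : exists x, K x /\ n%:R < `|x|.
  apply: contrapT => nK; apply: K_unbd; exists n%:R => x Kx.
  by rewrite leNgt; apply/negP => nx; apply: nK; exists x.
have [k k_incr [x Kx /weakly_cvg_bounded[M uM]]] :=
  weakly_compact_subseq K_cpt (fun n => (uP n).1).
have := uM (Num.truncn M).+1; rewrite leNgt => /negP; apply.
apply: lt_trans (truncnS_gt M) _; apply: le_lt_trans (uP _).2.
by rewrite ler_nat; exact: incr_ge.
Qed.

End eberlein_smulian.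

(** * Eberlein's dominated convergence *)

Section eberlein.
Context {R : realType} {T : topologicalType}.
Variables (K : set T) (K_cpt : compact K).
Implicit Types (f g : T -> R).

Definition bounded_on f := exists M, forall x, K x -> `|f x| <= M.

Lemma bounded_on_cst a : bounded_on (fun=> a).
Proof. by exists `|a|. Qed.

Lemma bounded_on_sum f g a b : bounded_on f -> bounded_on g ->
  bounded_on (fun x => a * f x + b * g x).
Proof.
move=> [M fM] [N gN]; exists (`|a| * M + `|b| * N) => x Kx.
by rewrite (le_trans (ler_normD _ _))// !normrM lerD// ler_wpM2l// ?fM ?gN.
Qed.

Lemma bounded_on_norm f : bounded_on f -> bounded_on (fun x => `|f x|).
Proof. by move=> [M fM]; exists M => x Kx; rewrite normr_id fM. Qed.

Lemma bounded_on_sqr f : bounded_on f -> bounded_on (fun x => f x ^+ 2).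
Proof.
move=> [M fM]; exists (M ^+ 2) => x Kx.
by rewrite normrX lerXn2r ?nnegrE ?fM// (le_trans _ (fM x Kx)).
Qed.

Inductive tail_hull (h : nat -> T -> R) n : set (T -> R) :=
| Tail_base k : (n <= k)%N -> tail_hull h n (h k)
| Tail_mid f g : tail_hull h n f -> tail_hull h n g ->
    tail_hull h n (fun x => 2^-1 * (f x + g x)).

Lemma tail_hull_sub h m n f : (m <= n)%N -> tail_hull h n f -> tail_hull h m f.
Proof.
move=> mn; elim=> [k nk|*]; last exact: Tail_mid.
by apply: Tail_base; exact: leq_trans nk.
Qed.

Variables (L : (T -> R) -> R).
Hypothesis L_sum : forall f g a b, bounded_on f -> bounded_on g ->
  L (fun x => a * f x + b * g x) = a * L f + b * L g.
Hypothesis L_le : forall f g, bounded_on f -> bounded_on g ->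
  (forall x, K x -> f x <= g x) -> L f <= L g.
Hypothesis L_cst : forall a, L (fun=> a) = a.

(** The pointwise inequality [|f| <= f^2 / (2 s) + s / 2] takes the place of Cauchy-Schwarz. *)
Lemma L_norm_le f s : 0 < s -> bounded_on f ->
  L (fun x => f x ^+ 2) <= s ^+ 2 -> L (fun x => `|f x|) <= s.
Proof.
move=> s0 f_bd Lf; pose a := (2 * s)^-1; pose b := s / 2.
apply: (@le_trans _ _ (L (fun x => a * f x ^+ 2 + b * 1))).
  apply: L_le; first exact: bounded_on_norm.
    by apply: bounded_on_sum; [exact: bounded_on_sqr|exact: bounded_on_cst].
  move=> x _; rewrite -subr_ge0 -real_normK ?num_real//.
  have -> : a * `|f x| ^+ 2 + b * 1 - `|f x| = a * (`|f x| - s) ^+ 2.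
    by rewrite /a /b; field; rewrite gt_eqF.
  by rewrite mulr_ge0 ?sqr_ge0// invr_ge0 mulr_ge0// ltW.
rewrite L_sum; [|exact: bounded_on_sqr|exact: bounded_on_cst].
rewrite L_cst; have a0 : 0 <= a by rewrite invr_ge0 mulr_ge0// ltW.
have -> : s = a * s ^+ 2 + b * 1 by rewrite /a /b; field; rewrite gt_eqF.
by rewrite lerD2r ler_wpM2l.
Qed.

Lemma dini (v : nat -> T -> R) (e : R) : (forall n, continuous (v n)) ->
  (forall n x, v n.+1 x <= v n x) ->
  (forall x, K x -> exists n, v n x < e) ->
  exists n, forall x, K x -> v n x < e.
Proof.
move=> v_cont v_decr v_lt.
have v_le m n x : (m <= n)%N -> v n x <= v m x.
  by move=> /subnK <-; elim: (n - m)%N => // k IH; exact: le_trans (v_decr _ _) IH.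
have [|N _ NK] := (compact_near_coveringP K).1 K_cpt nat \oo (fun n x => v n x < e) _.
  move=> x Kx; have [n vn] := v_lt x Kx.
  exists ([set y | v n y < e], [set m | (n <= m)%N]) => /=.
    split; last by exists n.
    exact: (cvgr_lt _ (v_cont n x)).
  by move=> [y m] /= [yn nm]; exact: le_lt_trans (v_le _ _ _ nm) yn.
by exists N => x Kx; exact: (NK N (leqnn N) x Kx).
Qed.

Variables (h : nat -> T -> R) (M : R).
Hypothesis h_cont : forall n, continuous (h n).
Hypothesis h_bd : forall n x, K x -> 0 <= h n x <= M.
Hypothesis h_cvg : forall x, K x -> forall e : R, 0 < e ->
  exists n, forall k, (n <= k)%N -> h k x <= e.

Lemma tail_hull_cont n f : tail_hull h n f -> continuous f.
Proof.
elim=> // {}f g _ fc _ gc x.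
by apply: (@cvgMl_tmp R); apply: cvgD; [exact: fc|exact: gc].
Qed.

Lemma tail_hull_bd n f : tail_hull h n f -> forall x, K x -> 0 <= f x <= M.
Proof.
elim=> [k _ x Kx|{}f g _ fM _ gM x Kx]; first exact: h_bd.
by have := fM x Kx; have := gM x Kx; lra.
Qed.

Lemma tail_hull_bounded n f : tail_hull h n f -> bounded_on f.
Proof.
move=> /tail_hull_bd fM; exists M => x /fM /andP[f0 fM'].
by rewrite ger0_norm.
Qed.

Lemma tail_hull_le n f x e : (forall k, (n <= k)%N -> h k x <= e) ->
  tail_hull h n f -> f x <= e.
Proof. by move=> he; elim=> [k /he//|{}f g _ fe _ ge]; lra. Qed.

Lemma tail_hull_L n f r : (forall k, r <= L (h k)) ->
  tail_hull h n f -> r <= L f.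
Proof.
move=> hr; elim=> // {}f g /tail_hull_bounded f_bd fr /tail_hull_bounded g_bd gr.
under eq_fun do rewrite mulrDr; rewrite L_sum//; lra.
Qed.

Lemma L_sqr_diff f g : bounded_on f -> bounded_on g ->
  L (fun x => (f x - g x) ^+ 2) = 2 * L (fun x => f x ^+ 2) +
    2 * L (fun x => g x ^+ 2) - 4 * L (fun x => (2^-1 * (f x + g x)) ^+ 2).
Proof.
move=> f_bd g_bd.
have m_bd : bounded_on (fun x => (2^-1 * (f x + g x)) ^+ 2).
  under eq_fun do rewrite mulrDr.
  exact: (bounded_on_sqr (bounded_on_sum _ _ f_bd g_bd)).
have f2 := bounded_on_sqr f_bd; have g2 := bounded_on_sqr g_bd.
rewrite (_ : (fun x => (f x - g x) ^+ 2) = (fun x =>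
    1 * (2 * f x ^+ 2 + 2 * g x ^+ 2) + (-4) * (2^-1 * (f x + g x)) ^+ 2)).
  by rewrite !L_sum ?mul1r ?mulNr//; exact: bounded_on_sum.
by apply/funext => x; field.
Qed.

(* Almost minimizers of [L f^2] over the tails form, by the parallelogram
   identity, a Cauchy sequence for the seminorm [L f^2]. *)
Lemma tail_hull_cauchy (d : nat -> R) :
  (forall k, 0 < d k) -> (forall k, d k.+1 <= d k) ->
  exists2 g : nat -> T -> R, forall k, tail_hull h k (g k) &
    forall k, L (fun x => (g k x - g k.+1 x) ^+ 2) <= 8 * d k.
Proof.
move=> d0 d_decr.
pose V n := [set L (fun x => f x ^+ 2) | f in tail_hull h n].
have sqr_bd n f : tail_hull h n f -> bounded_on (fun x => f x ^+ 2).
  by move=> /tail_hull_bounded; exact: bounded_on_sqr.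
have V_inf n : has_inf (V n).
  split; first by exists (L (fun x => h n x ^+ 2)), (h n) => //; exact: Tail_base.
  exists 0 => _ [f nf <-]; rewrite -(L_cst 0); apply: L_le.
  - exact: bounded_on_cst.
  - exact: sqr_bd nf.
  - by move=> x _; exact: sqr_ge0.
have V_le n : inf (V n) <= M ^+ 2.
  apply: (@le_trans _ _ (L (fun x => h n x ^+ 2))).
    by apply: ge_inf; [case: (V_inf n)|exists (h n) => //; exact: Tail_base].
  rewrite -(L_cst (M ^+ 2)); apply: L_le.
  - by apply: sqr_bd; exact: Tail_base (leqnn n).
  - exact: bounded_on_cst.
  - move=> x Kx; have /andP[h0 hM] := h_bd n Kx.
    by rewrite lerXn2r// nnegrE (le_trans h0).
have V_incr m n : (m <= n)%N -> inf (V m) <= inf (V n).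
  move=> mn; apply: lb_le_inf; first by case: (V_inf n).
  move=> _ [f nf <-]; apply: ge_inf; first by case: (V_inf m).
  by exists f => //; exact: tail_hull_sub nf.
pose D := [set inf (V n) | n in setT].
have D_sup : has_sup D.
  by split; [exists (inf (V 0%N)), 0%N|exists (M ^+ 2) => _ [n _ <-]].
(* The tail [n] is so late that its infimum is nearly the supremum of all the infima; the midpoint
   of two consecutive choices then has nearly the same quadratic mean as both. *)
have /choice[g gP] k : exists f, exists n, [/\ (k <= n)%N, tail_hull h n f,
    L (fun x => f x ^+ 2) < sup D + d k & sup D - d k < inf (V n)].
  have [_ [n _ <-] n_lt] := sup_adherent (d0 k) D_sup.
  pose m := maxn k n.
  have [_ [f mf <-] f_lt] := inf_adherent (d0 k) (V_inf m).
  exists f, m; split => //; first exact: leq_maxl.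
    apply: (lt_le_trans f_lt); rewrite lerD2r.
    by apply: ub_le_sup; [case: D_sup|exists m].
  by apply: (lt_le_trans n_lt); exact: V_incr (leq_maxr k n).
exists g => k; first by have [n [kn gn _ _]] := gP k; exact: tail_hull_sub gn.
have [m [km gm gm_lt Vm]] := gP k; have [n [kn gn gn_lt Vn]] := gP k.+1.
rewrite L_sqr_diff; [|exact: tail_hull_bounded gm|exact: tail_hull_bounded gn].
have dk := d_decr k.
suff : sup D - d k <= L (fun x => (2^-1 * (g k x + g k.+1 x)) ^+ 2) by lra.
apply: (@le_trans _ _ (inf (V (minn m n)))).
  by rewrite /minn; case: ifP => _; lra.
apply: ge_inf; first by case: (V_inf (minn m n)).
exists (fun x => 2^-1 * (g k x + g k.+1 x)) => //.
by apply: Tail_mid; [apply: tail_hull_sub gm|apply: tail_hull_sub gn];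
  [exact: geq_minl|exact: geq_minr].
Qed.

(** Dominated convergence for a finitely additive mean. If [L (h n) >= r] for all [n], the bound
    persists on the tail hulls. With the mean increments [L |g k - g k.+1|] summing to at most
    [r / 2], pointwise [g 0 <= w n + g n], where [g n] tends to 0; Dini's lemma gives
    [g 0 < w n + r / 4] on [K] for some [n], whence [L (g 0) <= 3 r / 4]. *)
Theorem eberlein_dominated r : 0 < r -> exists n, L (h n) < r.
Proof.
move=> r0; apply: contrapT => Lh.
have {}Lh n : r <= L (h n) by rewrite leNgt; apply/negP => ?; apply: Lh; exists n.
(* These numbers sum to [r / 2]; the choice [d k = s k ^+ 2 / 8] bounds the quadratic mean of the
   increments by [s k ^+ 2]. *)
pose s k := r / 4 * 2^-1 ^+ k.
have s0 k : 0 < s k by rewrite mulr_gt0 ?divr_gt0// exprn_gt0.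
have [||g gP gL] := @tail_hull_cauchy (fun k => s k ^+ 2 / 8).
- by move=> k; rewrite divr_gt0// exprn_gt0.
- move=> k; rewrite ler_pM2r//.
  rewrite lerXn2r ?nnegrE ?ltW// /s exprS; have := s0 k; rewrite /s; lra.
have g_bd k := tail_hull_bounded (gP k).
have u_bd k : bounded_on (fun x => g k x - g k.+1 x).
  by rewrite (_ : (fun x => _) = fun x => 1 * g k x + (-1) * g k.+1 x);
    [exact: bounded_on_sum|apply/funext => x; ring].
pose w n x := \sum_(k < n) `|g k x - g k.+1 x|.
have wS n : w n.+1 = fun x => 1 * w n x + 1 * `|g n x - g n.+1 x|.
  by apply/funext => x; rewrite /w big_ord_recr /= !mul1r.
have w_bd n : bounded_on (w n).
  elim: n => [|n IH]; last first.
    by rewrite wS; apply: bounded_on_sum => //; exact: bounded_on_norm.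
  rewrite (_ : w 0%N = fun=> 0); first exact: bounded_on_cst.
  by apply/funext => x; rewrite /w big_ord0.
have w_L n : L (w n) <= r / 2 * (1 - 2^-1 ^+ n).
  elim: n => [|n IH].
    rewrite (_ : w 0%N = fun=> 0); first by rewrite L_cst subrr mulr0.
    by apply/funext => x; rewrite /w big_ord0.
  rewrite wS L_sum//; last exact: bounded_on_norm.
  have : L (fun x => `|g n x - g n.+1 x|) <= s n.
    by apply: L_norm_le => //; rewrite (le_trans (gL n))// mulrC divfK.
  by rewrite /s exprS; lra.
have w_cont n : continuous (w n).
  elim: n => [|n IH] x.
    rewrite (_ : w 0%N = fun=> 0); first exact: cvg_cst.
    by apply/funext => y; rewrite /w big_ord0.
  rewrite (_ : w n.+1 = fun x => w n x + `|g n x - g n.+1 x|); last first.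
    by apply/funext => y; rewrite /w big_ord_recr.
  apply: cvgD; first exact: IH.
  by apply: cvg_norm; apply: cvgB; exact: tail_hull_cont (gP _) x.
have w_tele n x : g 0%N x - w n x <= g n x.
  elim: n => [|n IH]; first by rewrite /w big_ord0 subr0.
  rewrite /w big_ord_recr /= -/(w n x).
  have := ler_norm (g n x - g n.+1 x); lra.
have [|||n nK] := @dini (fun n x => g 0%N x - w n x) (r / 4).
- by move=> n x; apply: cvgB; [exact: tail_hull_cont (gP _) x|exact: w_cont].
- by move=> n x; rewrite lerD2l lerN2 /w big_ord_recr /= lerDl.
- move=> x Kx; have r8 : 0 < r / 8 by rewrite divr_gt0.
  have [n hn] := h_cvg Kx r8; exists n; apply: le_lt_trans (w_tele n x) _.
  by have := tail_hull_le hn (gP n); lra.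
have : L (g 0%N) <= L (fun x => 1 * w n x + 1 * (r / 4)).
  apply: L_le => //; first exact: bounded_on_sum (bounded_on_cst _).
  by move=> x /nK; lra.
rewrite L_sum//; last exact: bounded_on_cst.
have := tail_hull_L Lh (gP 0%N); rewrite L_cst => *.
have := w_L n; have : 0 < 2^-1 ^+ n :> R by rewrite exprn_gt0.
by move=> *; nra.
Qed.

End eberlein.

(** * Barycenters *)

Section barycenters.
Context {R : realType} {E : completeNormedModType R}.
Implicit Types (x y : E) (K W X : set E) (f : {linear E -> R^o}).
Local Notation wE := (weak_space E).

(* A functional on the dual at distance 0 from [E] in the bidual lies in [E]. *)
Lemma bidual_closed (L : {linear E -> R^o} -> R) :
  (forall e : R, 0 < e ->
     exists x, forall f, contractive f -> `|L f - f x| <= e) ->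
  exists x, forall f, contractive f -> L f = f x.
Proof.
move=> L_near.
have /choice[p pP] (n : nat) : exists x, forall f, contractive f ->
    `|L f - f x| <= n.+1%:R^-1 by apply: L_near; rewrite invr_gt0.
have p_dist m n : `|p m - p n| <= m.+1%:R^-1 + n.+1%:R^-1.
  have [f f1 <-] := norming (p m - p n).
  rewrite functionalB (le_trans (ler_norm _))//.
  rewrite (le_trans (ler_distD (L f) _ _))// (distrC _ (L f)).
  by rewrite lerD ?pP.
have inv_lt (e : R) : 0 < e -> exists n : nat, n.+1%:R^-1 < e.
  move=> e0; exists (Num.truncn e^-1).
  by rewrite invf_plt ?posrE// truncnS_gt.
have inv_le m n : (m <= n)%N -> n.+1%:R^-1 <= m.+1%:R^-1 :> R.
  by move=> mn; rewrite lef_pV2 ?posrE// ler_nat.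
have [x px] : exists x, p @ \oo --> x.
  apply/cvg_ex; apply: cauchy_cvg; apply: cauchy_exP => e e0.
  have [|m me] := inv_lt (e / 2); first by rewrite divr_gt0.
  exists (p m), m => // n /= /inv_le mn; rewrite -ball_normE /=.
  apply: le_lt_trans (p_dist m n) _.
  by rewrite (splitr e) ltrD//; exact: le_lt_trans mn me.
exists x => f f1; apply/eqP; rewrite -subr_eq0 -normr_le0.
apply/ler_addgt0Pr => e e0; rewrite add0r.
have e2 : 0 < e / 2 by rewrite divr_gt0.
have [m me] := inv_lt _ e2.
have /cvgrPdist_lt /(_ _ e2)[N _ pN] := px.
have xp := pN (maxn m N) (leq_maxr m N).
rewrite (splitr e) (le_trans (ler_distD (f (p (maxn m N)) : R) _ _))// lerD//.
  rewrite (le_trans (pP _ f f1))// (le_trans _ (ltW me))//.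
  exact: inv_le (leq_maxl m N).
by rewrite -functionalB (le_trans (f1 _))// distrC ltW.
Qed.

(** Relative weak compactness in terms of ultrafilters: the limit is sought in [E], not in [W]. *)
Definition weakly_ultra_cvg W := forall U : set_system E, UltraFilter U ->
  U W -> exists x, (U : set_system wE) --> (x : wE).

Lemma weakly_compact_ultra_cvg W : weakly_compact W -> weakly_ultra_cvg W.
Proof.
move=> /weakly_compactP W_cpt U U_ultra UW.
by have [x _ Ux] := W_cpt U U_ultra UW; exists x.
Qed.

Lemma weakly_ultra_cvg_compact W : closed W -> convex_set W ->
  weakly_ultra_cvg W -> weakly_compact W.
Proof.
move=> W_closed W_cvx W_ultra; apply/weakly_compactP => U U_ultra UW.
have [x Ux] := W_ultra U U_ultra UW; exists x => //.
apply: (mazur W_closed W_cvx) => A xA.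
by apply: (@filter_ex _ U); apply: filterI => //; exact: Ux.
Qed.

(** Grothendieck's criterion. The limit along [U] defines an element of the bidual; moving each [w]
    to a nearby [k w] in [K] changes it by at most [e] and turns it into a point of [E]. Being at
    distance 0 from [E], it lies in [E]. *)
Lemma weakly_ultra_cvg_approx W (M : R) : (forall x, W x -> `|x| <= M) ->
  (forall e : R, 0 < e -> exists2 K, weakly_ultra_cvg K &
     forall w, W w -> exists2 k, K k & `|w - k| <= e) ->
  weakly_ultra_cvg W.
Proof.
move=> W_bd W_approx U U_ultra UW.
have f_bd f : contractive f -> bounded_along U (f : E -> R).
  move=> f1; exists M; apply: filterS UW => x /W_bd; exact: le_trans.
have [|x Lx] := @bidual_closed (fun f => ulim U (f : E -> R)).
  move=> e e0; have [K K_ultra WK] := W_approx e e0.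
  have /choice[k kP] (w : E) : exists k, W w -> K k /\ `|w - k| <= e.
    have [/WK[k Kk wk]|nWw] := pselect (W w); first by exists k.
    by exists 0 => /nWw.
  have [|x kx] := K_ultra (k @ U) (ultra_fmap k U_ultra).
    by rewrite fmapE; apply: filterS UW => w /kP[].
  exists x => f f1.
  have /weak_cvgP/(_ f f1) fkx := kx.
  apply: (cvgr_to_le (cvg_norm (cvgB (ulimP (f_bd f f1)) fkx))).
  apply: filterS UW => w /kP[_ wk].
  by have := f1 (w - k w); rewrite functionalB => /le_trans; apply.
exists x; apply/weak_cvgP => f f1.
by rewrite -Lx//; exact: ulimP (f_bd f f1).
Qed.

End barycenters.

Section polytopes.
Context {R : realType} {E : normedModType R}.
Variable P : nat -> E.

(** The sum of the segments from 0 to [P j], a substitute for the convex hull of the [P j] whose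
    compactness and convexity follow by induction. *)
Fixpoint zonotope n : set E :=
  if n is n'.+1 then [set q.1 + q.2 *: P n' | q in zonotope n' `*` `[0, 1]]
  else [set 0].

Lemma zonotope0 n : zonotope n 0.
Proof.
elim: n => // n IH; exists (0, 0); last by rewrite /= scale0r addr0.
by split => //=; rewrite in_itv /= lexx ler01.
Qed.

Lemma zonotopeP n j : (j < n)%N -> zonotope n (P j).
Proof.
elim: n => // n IH; rewrite ltnS leq_eqVlt => /predU1P[->|/IH jn].
  exists (0, 1); last by rewrite /= scale1r add0r.
  by split => //=; [exact: zonotope0|rewrite in_itv /= lexx ler01].
exists (P j, 0); last by rewrite /= scale0r addr0.
by split => //=; rewrite in_itv /= lexx ler01.
Qed.

Lemma zonotope_convex n : convex_set (zonotope n).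
Proof.
apply/convex_setP; elim: n => [_ _ t -> -> _ _|n IH].
  by rewrite /= !scaler0 addr0.
move=> _ _ t [[u a] [/= Zu a01] <-] [[v b] [/= Zv b01] <-] t0 t1.
exists (t *: u + (1 - t) *: v, t * a + (1 - t) * b); last first.
  by rewrite /= [(t * a + _) *: _]scalerDl -!scalerA addrACA -!scalerDr.
split; first exact: IH.
move: a01 b01; rewrite /= !in_itv /= => /andP[a0 a1] /andP[b0 b1].
by apply/andP; split; nra.
Qed.

Lemma zonotope_compact n : compact (zonotope n).
Proof.
elim: n => [|n IH] /=; first exact: compact_set1.
apply: continuous_compact; last by apply: compact_setX => //; exact: segment_compact.
apply: continuous_subspaceT => -[x a].
apply: cvgD; first exact: cvg_fst.
by apply: cvgZ; [exact: cvg_snd|exact: cvg_cst].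
Qed.

End polytopes.

(** * Krein's theorem *)

Section krein.
Context {R : realType} {E : normedModType R}.
Implicit Types (x y : E) (K X : set E) (f : {linear E -> R^o}).
Implicit Types (m : (E -> R) -> R).
Local Notation wE := (weak_space E).

(** A finitely additive probability carried by [X], integrating every real function. *)
Definition mean X m := [/\
  forall g h a b, m (fun x => a * g x + b * h x) = a * m g + b * m h,
  forall g h, (forall x, X x -> g x <= h x) -> m g <= m h &
  forall a, m (fun=> a) = a].

Lemma hull_mean X y : midpoint_hull id X y ->
  exists2 m, mean X m & forall f, m f = f y.
Proof.
elim=> {y} [y Xy|//|y z _ [m [mD m_le m1] my] _ [n [nD n_le n1] nz]].
  by exists (fun g => g y) => //; split => // g h; exact.
exists (fun g => 2^-1 * m g + 2^-1 * n g).
  split=> [g h a b|g h gh|a]; first by rewrite mD nD; ring.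
    by rewrite lerD// ler_wpM2l// ?m_le ?n_le.
  by rewrite m1 n1; field.
by move=> f; rewrite my nz /midpoint linearZ linearD; apply/esym/mulrDr.
Qed.

Section mean_limit.
Variables (K X : set E).
Hypotheses (K_cpt : weakly_compact K) (X_countable : countable X).
Hypotheses (X0 : X !=set0) (XK : X `<=` K).
Variables (U : set_system E) (U_ultra : UltraFilter U).
Hypothesis UX : U (midpoint_hull id X).

Let H := midpoint_hull id X.
(** Large enough to carry the means, which live on [X], and norm-separable: an enumeration of [H]
    comes close to each of its points. *)
Let K' := K `&` closure H.

Let K'_cpt : @compact wE K'.
Proof.
apply: compact_closedI => //; apply: mazur; first exact: closed_closure.
by apply: closure_midpoint_convex => x y; exact: Hull_mid.
Qed.

Let XK' : X `<=` K'.
Proof. by move=> x Xx; split; [exact: XK|apply: subset_closure; exact: Hull_base]. Qed.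

(** Each point [y] of the hull is the barycenter of a mean [mu y] on [X]; the limit of these means
    along [U] is a mean whose barycenter is the limit of [U] in the bidual. *)
Lemma exists_limit_mean : exists L : (E -> R) -> R, [/\
  forall g h a b, @bounded_on R wE K' g -> @bounded_on R wE K' h ->
    L (fun x => a * g x + b * h x) = a * L g + b * L h,
  forall g h, @bounded_on R wE K' g -> @bounded_on R wE K' h ->
    (forall x, K' x -> g x <= h x) -> L g <= L h,
  forall a, L (fun=> a) = a &
  forall f, contractive f -> L f = ulim U (f : E -> R)].
Proof.
have [x0 Xx0] := X0.
have /choice[mu muP] (y : E) :
    exists m, mean X m /\ (H y -> forall f, m f = f y).
  have [/hull_mean[m m1 my]|nHy] := pselect (H y); first by exists m.
  exists (fun g => g x0); split => //; split => // g h; exact.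
have mu_bd g : @bounded_on R wE K' g -> bounded_along U (fun y => mu y g).
  move=> [M gM]; exists M; apply: filterE => y /=.
  have [[mD m_le m1] _] := muP y.
  rewrite ler_norml -[X in _ && (_ <= X)](m1 M) -[X in (X <= _) && _](m1 (- M)).
  by apply/andP; split; apply: m_le => x /XK' /gM; rewrite ler_norml => /andP[].
exists (fun g => ulim U (fun y => mu y g)); split.
- move=> g h a b g_bd h_bd; rewrite -ulim_sum; try exact: mu_bd.
  by congr (ulim U _); apply/funext => y; have [[]] := muP y.
- move=> g h g_bd h_bd gh; apply: ulim_le; try exact: mu_bd.
  apply: filterE => y /=; have [[_ m_le _] _] := muP y.
  by apply: m_le => x /XK'; exact: gh.
- move=> a; rewrite -[RHS](ulim_cst (U := U)).
  by congr (ulim U _); apply/funext => y; have [[]] := muP y.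
- move=> f f1; have [M KM] := weakly_compact_bounded K_cpt.
  have f_bd : @bounded_on R wE K' (f : E -> R).
    by exists M => x [/KM xM _]; exact: le_trans (f1 x) xM.
  apply/esym/ulim_cvg; apply: cvg_trans (ulimP (mu_bd _ f_bd)).
  apply: near_eq_cvg; apply: filterS UX => y Hy.
  by have [_] := muP y; apply.
Qed.

(* [h_n], the part of [f_n] above [q_n + e], vanishes on the first [n] balls of
   radius [e]; these balls exhaust [K'], so that [h_n] tends to 0 pointwise. *)
Lemma limit_mean_cover (e : R) : 0 < e ->
  exists P : nat -> E, exists N, forall f (q : R), contractive f ->
    (forall j, (j < N)%N -> f (P j) <= q) -> ulim U (f : E -> R) <= q + 2 * e.
Proof.
move=> e0; have [L [L_sum L_le L_cst L_f]] := exists_limit_mean.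
have H0 : H !=set0 by have [x Xx] := X0; exists x; exact: Hull_base.
have [P HP PH] := countable_enumeration (midpoint_hull_countable id X_countable) H0.
exists P; apply: contrapT => no_cover.
have /choice[fq fqP] (n : nat) : exists fq : {linear E -> R^o} * R,
    [/\ contractive fq.1, forall j, (j < n.+1)%N -> fq.1 (P j) <= fq.2 &
    fq.2 + 2 * e < ulim U (fq.1 : E -> R)].
  apply: contrapT => no_fq; apply: no_cover; exists n.+1 => f q f1 fPq.
  by rewrite leNgt; apply/negP => ?; apply: no_fq; exists (f, q).
pose u n (x : E) : R := (fq n).1 x - (fq n).2 - e.
pose h n (x : E) : R := 2^-1 * (`|u n x| + u n x).
have [M KM] := weakly_compact_bounded K_cpt.
have u_le n x : K' x -> u n x <= M + `|P 0%N|.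
  move=> [/KM xM _]; have [f1 /(_ 0%N isT) fP _] := fqP n; rewrite /u.
  have := ler_norm ((fq n).1 x : R); have := ler_norm (- ((fq n).1 (P 0%N)) : R).
  have := f1 x; have := f1 (P 0%N); rewrite normrN => *; lra.
have h_cases n x : h n x = 0 /\ u n x <= 0 \/ h n x = u n x /\ 0 <= u n x.
  rewrite /h; have [u0|u0] := leP 0 (u n x).
    by right; split => //; rewrite ger0_norm//; field.
  by left; split; [rewrite ltr0_norm// addNr mulr0|exact: ltW].
have P0 : 0 <= M + `|P 0%N|.
  by have [x Xx] := X0; rewrite addr_ge0// (le_trans _ (KM x (XK Xx))).
have h_bd n x : K' x -> 0 <= h n x <= M + `|P 0%N|.
  by move=> /(u_le n); case: (h_cases n x) => -[-> ?] ?; rewrite ?lexx//; apply/andP.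
have [||n] := @eberlein_dominated R wE K' K'_cpt L L_sum L_le L_cst h
  (M + `|P 0%N|) _ h_bd _ e e0.
- move=> n x; have [f1 _ _] := fqP n.
  have u_cont : (u n : wE -> R) @ nbhs (x : wE) --> u n x.
    do 2 (apply: cvgB; last exact: cvg_cst).
    exact: (@contractive_weak_continuous R E _ f1 x).
  exact: (cvgMl_tmp (cvgD (cvg_norm u_cont) u_cont)).
- move=> x [_ /closure_normP Hx] d d0; have [_ /PH[j _ <-] xj] := Hx _ e0.
  exists j => n jn; have [f1 fP _] := fqP n.
  have : u n x <= 0.
    rewrite /u; have := fP j jn; have := f1 (x - P j); rewrite functionalB.
    by move=> fx fPj; have := ler_norm ((fq n).1 x - (fq n).1 (P j) : R); lra.
  by case: (h_cases n x) => -[-> ?] ?; rewrite ?(ltW d0)//; lra.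
apply/negP; rewrite -leNgt.
have [f1 _ fL] := fqP n; rewrite -L_f// in fL.
have f_bd : @bounded_on R wE K' (fun x => (fq n).1 x).
  by exists M => x [/KM xM _]; exact: le_trans (f1 x) xM.
have cst_bd a : @bounded_on R wE K' (fun=> a) by exact: bounded_on_cst.
have : L (fun x => 1 * (fq n).1 x + 1 * - ((fq n).2 + e)) <= L (h n).
  apply: L_le.
  - by apply: bounded_on_sum.
  - by exists (M + `|P 0%N|) => x /(h_bd n)/andP[h0 hM]; rewrite ger0_norm.
  - move=> x _; have := h_cases n x; rewrite /u; move: (h n x) ((fq n).1 x : R) => *; lra.
by rewrite L_sum// L_cst => ?; lra.
Qed.

Lemma limit_mean_bounded f : contractive f -> bounded_along U (f : E -> R).
Proof.
move=> f1.
have [M KM] := weakly_compact_bounded K_cpt.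
exists M; apply: filterS UX => y /hull_mean[m [_ m_le m1] my].
have fM x : X x -> `|f x : R| <= M by move=> /XK/KM; exact: le_trans (f1 x).
rewrite /= -my ler_norml -[X in _ && (_ <= X)](m1 M).
rewrite -[X in (X <= _) && _](m1 (- M)).
by apply/andP; split; apply: m_le => x /fM; rewrite ler_norml => /andP[].
Qed.

(** Were [T] at distance at least [e] from the zonotope, separation would give a [g] with
    [g (P j) <= ulim U g - e] for all [j < N]. The covering property at [e / 4] allows a loss of
    [e / 2] only. *)
Lemma limit_mean_meets (e : R) : 0 < e ->
  exists P : nat -> E, exists N, forall T : set E, convex_set T -> U T ->
    exists t v, [/\ T t, zonotope P N v & `|t - v| < e].
Proof.
move=> e0; have [|P [N PN]] := @limit_mean_cover (e / 4).
  by rewrite divr_gt0.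
exists P, N => T T_cvx UT; apply: contrapT => no_meet.
have [|||f f1 fe] := @separation R E [set t - v | t in T & v in zonotope P N] e.
- have [t Tt] := @filter_ex _ U _ _ UT.
  by exists (t - 0), t => //; exists 0 => //; exact: zonotope0.
- move/convex_setP in T_cvx; have /convex_setP Z_cvx := @zonotope_convex R E P N.
  apply/convex_setP => _ _ a [t Tt [v Zv <-]] [s Ts [w Zw <-]] a0 a1.
  exists (a *: t + (1 - a) *: s); first exact: T_cvx.
  exists (a *: v + (1 - a) *: w); first exact: Z_cvx.
  by rewrite !scalerBr opprD addrACA.
- move=> _ [t Tt [v Zv <-]]; rewrite leNgt; apply/negP => tv.
  by apply: no_meet; exists t, v.
have [g g1 gE] := contractive_opp f1.
have fP j : (j < N)%N -> g (P j) <= ulim U (g : E -> R) - e.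
  move=> /(zonotopeP P) Zj; rewrite -(ulim_cst (U := U) e).
  have -> : ulim U (g : E -> R) - ulim U (fun=> e) =
      1 * ulim U (g : E -> R) + (-1) * ulim U (fun=> e) by ring.
  have cst_bd (a : R) : bounded_along U (fun=> a : R).
    by exists `|a|; apply: filterE => x /=.
  rewrite -ulim_sum//; last exact: limit_mean_bounded.
  rewrite -[X in X <= _](ulim_cst (U := U)); apply: ulim_le => //.
    by apply: bounded_along_sum => //; exact: limit_mean_bounded.
  apply: filterS UT => t Tt /=.
  have : f (t - P j) <= - e by apply: fe; exists t => //; exists (P j).
  rewrite functionalB !gE; move: (f t : R) (f (P j) : R) => a b; lra.
have := PN g _ g1 fP; lra.
Qed.

(** The points of the zonotope near [T], for [T] convex in [U], generate a filter on a compact set;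
    a cluster point [p] serves all [f] at once, by taking for [T] the slab where [f] is within
    [e / 4] of its limit. The errors are [e / 4 + e / 2 + e / 4]. *)
Lemma limit_mean_point (e : R) : 0 < e ->
  exists p, forall f, contractive f -> `|ulim U (f : E -> R) - f p| <= e.
Proof.
move=> e0; have e2 : 0 < e / 2 by rewrite divr_gt0.
have e4 : 0 < e / 4 by rewrite divr_gt0.
have [P [N meets]] := limit_mean_meets e2.
pose B (T : set E) :=
  [set v | zonotope P N v /\ exists2 t, T t & `|t - v| < e / 2].
pose F := filter_from [set T : set E | convex_set T /\ U T] B.
have F_proper : ProperFilter F.
  apply: filter_from_proper; last first.
    move=> T [T_cvx UT]; have [t [v [Tt Zv tv]]] := meets T T_cvx UT.
    by exists v; split => //; exists t.
  apply: filter_from_filter.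
    by exists setT; split; [move=> *; rewrite inE|exact: filterT].
  move=> S T [/convex_setP S_cvx US] [/convex_setP T_cvx UT]; exists (S `&` T).
    split; last exact: filterI.
    apply/convex_setP => x y a [Sx Tx] [Sy Ty] a0 a1.
    by split; [exact: S_cvx|exact: T_cvx].
  by move=> v [Zv [t [St Tt] tv]]; split; split => //; exists t.
have FZ : F (zonotope P N).
  by exists setT; [split; [move=> *; rewrite inE|exact: filterT]|move=> v []].
have [p [_ Fp]] := @zonotope_compact R E P N F F_proper FZ.
exists p => f f1; pose T := [set y | `|ulim U (f : E -> R) - f y| <= e / 4].
have T_cvx : convex_set T.
  apply/convex_setP => x y a Tx Ty a0 a1; rewrite /T /= functionalP.
  move: Tx Ty; rewrite /T /= !ler_norml; set l := ulim _ _.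
  move: (f x : R) (f y : R) => b c /andP[h1 h2] /andP[h3 h4].
  by apply/andP; split; nra.
have UT : U T.
  have fU : (f : E -> R) @ U --> ulim U (f : E -> R).
    exact: ulimP (limit_mean_bounded f1).
  by move/cvgrPdist_le: fU => /(_ _ e4).
have [|v [[_ [t Tt tv]] pv]] := Fp (B T) (ball p (e / 4)) _ (nbhsx_ballx _ _ e4).
  by exists T.
rewrite -ball_normE /= in pv.
have ft := f1 (t - v); have fv := f1 (p - v).
rewrite functionalB in ft; rewrite functionalB in fv.
have ft' := le_lt_trans ft tv; have fv' := le_lt_trans fv pv.
move: Tt ft' fv'; rewrite /T /= !ltr_norml !ler_norml.
move: (f t : R) (f v : R) (f p : R) (ulim U _) => a b c l.
by move=> /andP[h1 h2] /andP[h3 h4] /andP[h5 h6]; apply/andP; split; lra.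
Qed.

End mean_limit.
End krein.

Section krein_smulian.
Context {R : realType} {E : completeNormedModType R}.
Implicit Types (K X : set E).

(** For an ultrafilter on the hull, the limit in the bidual is within every [e] of a point of [E];
    completeness of [E] makes it a weak limit in [E], and approximation extends this to the
    closure. *)
Theorem krein_smulian K X : weakly_compact K -> countable X -> X !=set0 ->
  X `<=` K -> weakly_compact (closure (midpoint_hull id X)).
Proof.
move=> K_cpt X_countable X0 XK; pose H := midpoint_hull id X.
have H_ultra : weakly_ultra_cvg H.
  move=> U U_ultra UH.
  have [x Lx] := bidual_closed (limit_mean_point K_cpt X_countable X0 XK U_ultra UH).
  exists x; apply/weak_cvgP => f f1; rewrite -Lx//; apply: ulimP.
  exact: (@limit_mean_bounded R E K X K_cpt XK U U_ultra UH f f1).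
have [M KM] := weakly_compact_bounded K_cpt.
have HM x : H x -> `|x| <= M.
  elim=> {x} [x /XK/KM//|//|x y _ xM _ yM].
  rewrite /midpoint normrZ gtr0_norm ?invr_gt0//.
  by have := ler_normD x y; lra.
have cl_approx x (e : R) : closure H x -> 0 < e -> exists2 y, H y & `|x - y| <= e.
  by move=> /closure_normP Hx e0; have [y Hy /ltW] := Hx e e0; exists y.
apply: weakly_ultra_cvg_compact; first exact: closed_closure.
  by apply: closure_midpoint_convex => x y; exact: Hull_mid.
apply: (@weakly_ultra_cvg_approx _ _ _ (M + 1)).
  move=> x /cl_approx /(_ ltr01)[y /HM yM xy].
  by have := ler_normD (x - y) y; rewrite subrK; lra.
by move=> e e0; exists H => // x /cl_approx; apply.
Qed.

End krein_smulian.

(** * The Knaster-Kuratowski-Mazurkiewicz lemma *)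

Section knaster_kuratowski_mazurkiewicz.
Context {R : realType} {E : normedModType R}.
Variables (n : nat) (y : 'I_n.+1 -> E).

Definition weights (w : 'I_n.+1 -> R) :=
  (forall i, 0 <= w i) /\ \sum_i w i = 1.

Definition combination (w : 'I_n.+1 -> R) : E := \sum_i w i *: y i.

Theorem knaster_kuratowski_mazurkiewicz (label : E -> 'I_n.+1) (e : R) :
  0 < e -> exists w, weights w /\ exists C : pred 'I_n.+1,
    (forall i, ~~ C i -> w i <= e) /\
    (forall i, C i -> exists w', [/\ weights w', label (combination w') = i &
       `|combination w' - combination w| <= e]).
Proof.
move=> e0; pose M : R := 1 + \sum_i `|y i|.
have M1 : 1 <= M by rewrite lerDl sumr_ge0.
(* Grid coordinates are controlled up to [n + 1] out of [N]; this [N] brings the error on weights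
   and on combinations below [e]. *)
pose N := (Num.truncn (n.+1%:R * M / e)).+1.
have N0 : 0 < N%:R :> R by rewrite ltr0n.
have NM : n.+1%:R / N%:R * M <= e.
  rewrite mulrAC ler_pdivrMr// -ler_pdivrMl// mulrC.
  exact/ltW/truncnS_gt.
pose wt (t : grid 'I_n.+1 N) i : R := (grid_coord t i)%:R / N%:R.
have wtP t : weights (wt t).
  split=> [i|]; first by rewrite divr_ge0.
  by rewrite -mulr_suml -natr_sum sum_coord divff// gt_eqF.
have [|F [C [/set0Pn C0 C_lab C_out F_close]]] :=
  @knaster_kuratowski_mazurkiewicz_grid _ N (fun t => label (combination (wt t))).
  by rewrite card_ord.
rewrite card_ord in C_out F_close.
have [i0 Ci0] := C0; have [s0 Fs0 _] := C_lab i0 Ci0.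
have nN : n.+1%:R / N%:R <= e :> R.
  by apply: le_trans NM; rewrite ler_peMr// divr_ge0.
exists (wt s0); split => //; exists (mem C); split => [i Ci|i Ci].
  apply: le_trans nN; rewrite /wt ler_pM2r ?invr_gt0// ler_nat.
  exact: C_out.
have [s Fs lab_s] := C_lab i Ci; exists (wt s); split => //.
rewrite /combination -sumrB; under eq_bigr do rewrite -scalerBl.
apply: (le_trans (ler_norm_sum _ _ _)); apply: le_trans NM.
apply: (@le_trans _ _ (\sum_i n.+1%:R / N%:R * `|y i|)).
  apply: ler_sum => j _; rewrite normrZ ler_wpM2r//.
  rewrite /wt -mulrBl normrM [`|_^-1|]gtr0_norm ?invr_gt0//.
  rewrite ler_pM2r ?invr_gt0// ler_norml lerBrDr lerBlDr addrC -opprB.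
  have := F_close s s0 j Fs Fs0; have := F_close s0 s j Fs0 Fs.
  by rewrite -!(ler_nat R) !natrD => *; apply/andP; split; lra.
by rewrite -mulr_sumr ler_wpM2l ?divr_ge0// lerDr.
Qed.

End knaster_kuratowski_mazurkiewicz.

(** * Approximate fixed points *)

Section halfspace_fixed_point.
Context {R : realType} {E : normedModType R}.
Implicit Types (x y z : E) (C D : set E) (h : {linear E -> R^o}).
Local Notation wE := (weak_space E).

Lemma convex_combination D (I : Type) (s : seq I) (w : I -> R) (y : I -> E) :
  convex_set D -> D !=set0 -> (forall i, 0 <= w i) -> (forall i, D (y i)) ->
  exists2 d, D d & \sum_(i <- s) w i *: y i = (\sum_(i <- s) w i) *: d.
Proof.
move=> /convex_setP D_cvx [d0 Dd0] w0 Dy; elim: s => [|i s [d Dd sE]].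
  by exists d0; rewrite // !big_nil scale0r.
rewrite !big_cons sE; set t := \sum_(j <- s) w j.
have t0 : 0 <= t by exact: sumr_ge0.
have [wt0|wt0] := eqVneq (w i + t) 0.
  exists d0 => //; rewrite wt0 scale0r; have wi0 := w0 i.
  have -> : w i = 0 by lra.
  have -> : t = 0 by lra.
  by rewrite !scale0r addr0.
exists (w i / (w i + t) *: y i + (1 - w i / (w i + t)) *: d).
  apply: D_cvx => //; first by rewrite divr_ge0// addr_ge0.
  have wt_gt0 : 0 < w i + t by rewrite lt_def wt0 addr_ge0.
  by rewrite ler_pdivrMr// mul1r lerDl.
rewrite scalerDr !scalerA; congr (_ *: _ + _ *: _); by field.
Qed.

Section approximation.
Variables (C : set E) (f : E -> E) (p : nat -> {linear E -> R^o}).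
Hypotheses (C_countable : countable C) (C0 : C !=set0).
Hypotheses (C_f : forall x, C x -> C (f x)).
Hypotheses (D_convex : convex_set (closure C)).
Hypotheses (D_cpt : weakly_compact (closure C)).
Hypotheses (p1 : forall n, contractive (p n)).
Hypotheses (p_sep : forall x y, closure C x -> closure C y ->
  (forall n, p n x = p n y) -> x = y).

Lemma exists_net n : exists m, exists e : 'I_m.+1 -> E, (forall i, C (e i)) /\
  forall z, closure C z -> exists i, forall j, (j <= n)%N ->
    `|(p j z : R) - p j (e i)| <= n.+1%:R^-1.
Proof.
have [e Ce eC] := countable_enumeration C_countable C0.
pose P m z := exists2 i, (i <= m)%N & forall j, (j <= n)%N ->
    `|(p j z : R) - p j (e i)| <= n.+1%:R^-1.
have [|m _ mP] := (@compact_near_coveringP wE (closure C)).1 D_cpt nat \oo P _.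
  move=> x Cx; have n0 : 0 < n.+1%:R^-1 :> R by rewrite invr_gt0.
  have [_ /eC[i _ <-] xi] := (closure_normP _ _).1 Cx _ n0.
  have near_j (j : 'I_n.+1) : \forall z \near (x : wE),
      `|(p j z : R) - p j (e i)| <= n.+1%:R^-1.
    have pjx : (fun z => `|(p j z : R) - p j (e i)|) @ nbhs (x : wE) -->
        `|(p j x : R) - p j (e i)|.
      apply: cvg_norm; apply: cvgB; last exact: cvg_cst.
      exact: (@contractive_weak_continuous R E _ (p1 j) x).
    have pjx_lt : `|(p j x : R) - p j (e i)| < n.+1%:R^-1.
      by rewrite -functionalB; exact: le_lt_trans (p1 j _) xi.
    by apply: filterS (cvgr_lt _ pjx _ pjx_lt) => z /ltW.
  exists ([set z : wE | forall j : 'I_n.+1,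
      `|(p j z : R) - p j (e i)| <= n.+1%:R^-1], [set m | (i <= m)%N]) => /=.
    by split; [exact: filter_forall _ near_j|exists i].
  move=> [z m] /= [zx im]; exists i => // j jn.
  exact: (zx (Ordinal (jn : (j < n.+1)%N))).
exists m, (e \o val); split => [i|z Cz]; first exact: Ce.
have [i im zi] := mP m (leqnn m) z Cz.
by exists (Ordinal (im : (i < m.+1)%N)).
Qed.

(** A discrete form of Kakutani's argument: the vertices are the images [f (e i)] of a finite net,
    and each point is labelled by a net point near it. In the combination given by the covering
    lemma a weight is negligible unless [e i] is near [z], so [z] is almost a convex combination of
    values of [f] near [z]. *)
Lemma approximate_fixed_point n : exists2 z, closure C z &
  forall h c (M : R), 0 <= M -> (forall x, C x -> h (f x) <= c + M) ->
    (forall x, C x -> (forall j, (j <= n)%N ->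
       `|(p j x : R) - p j z| <= 2 * n.+1%:R^-1) -> h (f x) <= c) ->
    h z <= c + M * n.+1%:R^-1.
Proof.
have [m [e [Ce net]]] := exists_net n.
have n0 : 0 < n.+1%:R^-1 :> R by rewrite invr_gt0.
have m0 : 0 < m.+1%:R^-1 :> R by rewrite invr_gt0.
have m1 : m.+1%:R^-1 <= 1 :> R by rewrite invf_le1// ler1n.
have /choice[label labelP] z : exists i, closure C z -> forall j, (j <= n)%N ->
    `|(p j z : R) - p j (e i)| <= n.+1%:R^-1.
  have [Cz|nCz] := pselect (closure C z); last by exists ord0 => /nCz.
  by have [i zi] := net z Cz; exists i.
(* With this tolerance the at most [m + 1] negligible weights sum to at most [1 / (n + 1)]. *)
have [w [[w0 w1] [Q [Qout Qin]]]] := knaster_kuratowski_mazurkiewicz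
  (f \o e) label (mulr_gt0 n0 m0).
have C_cl x : C x -> closure C x by exact: subset_closure.
have comb_C w' : weights w' -> closure C (combination (f \o e) w').
  move=> [w'0 w'1]; have [||d Cd] := @convex_combination (closure C) _
    (index_enum 'I_m.+1) w' (f \o e) D_convex _ w'0.
  - by have [x Cx] := C0; exists x; exact: C_cl.
  - by move=> i; exact/C_cl/C_f/Ce.
  by rewrite w'1 scale1r => dE; rewrite /combination dE.
exists (combination (f \o e) w) => [|h c M M0 hM hc]; first exact: comb_C.
have hE : h (combination (f \o e) w) = \sum_i w i * (h (f (e i)) : R).
  by rewrite linear_sum; apply: eq_bigr => i _; rewrite linearZ.
rewrite hE; apply: (@le_trans _ _ (\sum_i (w i * c + M * (n.+1%:R^-1 * m.+1%:R^-1)))).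
  apply: ler_sum => i _; have [Qi|Qi] := boolP (Q i).
    rewrite (@le_trans _ _ (w i * c))//; last by rewrite lerDl !mulr_ge0// ltW.
    rewrite ler_wpM2l//; apply: hc => // j jn.
    have [w' [w'P lab w'w]] := Qin i Qi.
    have := labelP _ (comb_C w' w'P) j jn; rewrite lab.
    have := le_trans (p1 j _) w'w; rewrite functionalB.
    have : n.+1%:R^-1 * m.+1%:R^-1 <= n.+1%:R^-1 :> R by rewrite ler_piMr// ltW.
    move: (p j _ : R) (p j _ : R) (p j _ : R) => a b d.
    move: (n.+1%:R^-1 * m.+1%:R^-1) => r; move: n.+1%:R^-1 => s.
    rewrite !ler_norml => h0 /andP[h1 h2] /andP[h3 h4].
    by apply/andP; split; lra.
  apply: (@le_trans _ _ (w i * (c + M))); first by rewrite ler_wpM2l// hM.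
  by rewrite mulrDr lerD2l mulrC ler_wpM2l// Qout.
rewrite big_split /= -mulr_suml w1 mul1r lerD2l.
rewrite sumr_const card_ord -[leLHS]mulr_natr -!mulrA mulVf ?mulr1//.
Qed.

(** By compactness of the closure, a bound [c] on the weak limits of [f] at [z] bounds [h (f x)] by
    [c + d / 2] as soon as finitely many [p j] are almost equal at [x] and [z]; the approximate
    solutions carry this bound to [z]. *)
Theorem halfspace_fixed_point : exists2 z, closure C z &
  forall h c, contractive h ->
    (forall u g, (forall n, C (u n)) -> weakly_cvg_to u z ->
       weakly_cvg_to (f \o u) g -> h g <= c) ->
    h z <= c.
Proof.
have /choice[z zP] n : exists z, closure C z /\
    forall h c (M : R), 0 <= M -> (forall x, C x -> h (f x) <= c + M) ->
    (forall x, C x -> (forall j, (j <= n)%N ->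
       `|(p j x : R) - p j z| <= 2 * n.+1%:R^-1) -> h (f x) <= c) ->
    h z <= c + M * n.+1%:R^-1.
  by have [z] := approximate_fixed_point n; exists z.
have C_cl x : C x -> closure C x by exact: subset_closure.
have [k k_incr [z0 Cz0 kz]] := weakly_compact_subseq D_cpt (fun n => (zP n).1).
exists z0 => // h c h1 hc; apply/ler_addgt0Pr => d d0.
have d2 : 0 < d / 2 by rewrite divr_gt0.
have [m mP] : exists m, forall x, C x -> (forall j, (j <= m)%N ->
    `|(p j x : R) - p j z0| <= m.+1%:R^-1) -> h (f x) <= c + d / 2.
  apply: contrapT => no_m.
  have /choice[u uP] m : exists x, [/\ C x, forall j, (j <= m)%N ->
      `|(p j x : R) - p j z0| <= m.+1%:R^-1 & c + d / 2 < h (f x)].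
    apply: contrapT => no_x; apply: no_m; exists m => x Cx xm.
    by rewrite leNgt; apply/negP => ?; apply: no_x; exists x.
  have uz : weakly_cvg_to u z0.
    apply: (separated_weakly_cvg_to D_cpt p1 p_sep) => //.
      by move=> n; apply: C_cl; have [] := uP n.
    move=> j; apply/cvgrPdist_le => e e0; near=> n.
    rewrite distrC; have [_ un _] := uP n.
    apply: (le_trans (un j _)); first by near: n; exact: nbhs_infty_ge.
    by apply/ltW; near: n; exact: (near_infty_natSinv_lt (PosNum e0)).
  have [|l l_incr [g _ lg]] := @weakly_compact_subseq R E _ (f \o u) D_cpt.
    by move=> n; apply/C_cl/C_f; have [] := uP n.
  have hg : h g <= c.
    apply: (hc (u \o l)) => //; first by move=> n; have [] := uP (l n).
    exact: weakly_cvg_to_subseq.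
  have : c + d / 2 <= h g.
    have := (weakly_cvg_toP _ _).1 lg h h1.
    move=> /cvgr_to_ge; apply; apply: nearW => n /=.
    by apply/ltW; have [] := uP (l n).
  by lra.
have [M DM] := weakly_compact_bounded D_cpt.
(* A crude bound on all of [C] is enough, since it is multiplied by a vanishing weight. *)
pose M' := `|M| + `|c + d / 2|.
have hM x : C x -> h (f x) <= c + d / 2 + M'.
  move=> Cx; rewrite (le_trans (ler_norm _))// (le_trans (h1 _))//.
  rewrite (le_trans (DM _ (C_cl _ (C_f Cx))))//.
  have := ler_norm M; have := ler_norm (- (c + d / 2)); rewrite normrN /M'; lra.
have kz_cvg j : (fun n => p j (z (k n)) : R) @ \oo --> (p j z0 : R).
  exact: (weakly_cvg_toP _ _).1 kz _ (p1 j).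
have m0 : 0 < m.+1%:R^-1 / 2 :> R by rewrite divr_gt0// invr_gt0.
have inv_cvg (a : R) : 0 < a -> \forall n \near \oo, (k n).+1%:R^-1 < a.
  move=> a0; have [N _ NP] := near_infty_natSinv_lt (PosNum a0).
  by exists N => // n Nn; apply: NP; exact: leq_trans Nn (incr_ge k_incr n).
have M'0 : 0 <= M' by rewrite addr_ge0.
have z_le : \forall n \near \oo, h (z (k n)) <= c + d / 2 + M' * (k n).+1%:R^-1.
  have near_z : \forall n \near \oo, forall j : 'I_m.+1,
      `|(p j z0 : R) - p j (z (k n))| < m.+1%:R^-1 / 2.
    have near_j (j : 'I_m.+1) : \forall n \near \oo,
        `|(p j z0 : R) - p j (z (k n))| < m.+1%:R^-1 / 2.
      by move/cvgrPdist_lt: (kz_cvg j) => /(_ _ m0).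
    exact: filter_forall near_j.
  near=> n; apply: (zP (k n)).2 => // x Cx xz; apply: mP => // j jm.
  have mk : (m <= k n)%N.
    by apply: leq_trans (incr_ge k_incr n); near: n; exact: nbhs_infty_ge.
  have kn : (k n).+1%:R^-1 < m.+1%:R^-1 / 4 :> R.
    by near: n; apply: inv_cvg; rewrite divr_gt0// invr_gt0.
  have jz : `|(p j z0 : R) - p j (z (k n))| < m.+1%:R^-1 / 2.
    by have := near near_z n => /(_ _ (Ordinal (jm : (j < m.+1)%N))); apply.
  have := xz j (leq_trans jm mk); move: jz kn.
  move: (p j z0 : R) (p j x : R) (p j (z (k n)) : R) => a b e.
  move: m.+1%:R^-1 (k n).+1%:R^-1 => r s.
  rewrite !ler_norml !ltr_norml => /andP[h1' h2'] h3' /andP[h4' h5'].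
  by apply/andP; split; lra.
have : h z0 <= c + d / 2 + d / 2; last by lra.
have hz := (weakly_cvg_toP _ _).1 kz _ h1.
apply: (cvgr_to_le hz); have [M'0'|M'_neq0] := eqVneq M' 0.
  apply: filterS z_le => n; rewrite M'0' mul0r addr0 => /le_trans; apply.
  by rewrite lerDl ltW.
have d_gt0 : 0 < M'^-1 * (d / 2) by rewrite mulr_gt0// invr_gt0 lt_def M'_neq0.
apply: filterS2 z_le (inv_cvg _ d_gt0) => n hzn /ltW.
rewrite ler_pdivlMl ?lt_def ?M'_neq0// => kn.
by rewrite (le_trans hzn)// lerD2l.
Unshelve. all: by end_near. Qed.

End approximation.
End halfspace_fixed_point.

(** * De Blasi's measure and sums of mappings *)

Section de_blasi_measure.
Context {R : realType} {E : normedModType R}.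
Implicit Types (x y : E) (K W : set E).
Local Notation wE := (weak_space E).

Lemma bounded_setP W :
  bounded_set W <-> exists M : R, forall x, W x -> `|x| <= M.
Proof.
split=> [/pinfty_ex_gt0[M _ WM]|[M WM]]; first by exists M.
exists M; split; first exact: num_real.
by move=> N MN x /WM xM; exact: le_trans xM (ltW MN).
Qed.

Lemma closed_ball0P (e : R) x : 0 < e -> closed_ball 0 e x <-> `|x| <= e.
Proof. by move=> e0; rewrite closed_ballE// /closed_ball_ /= sub0r normrN. Qed.

Definition weakly_approximable W (e : R) := exists2 K, weakly_compact K &
  forall w, W w -> exists2 k, K k & `|w - k| <= e.

Lemma weakly_approximableP W (e : R) : 0 < e -> weakly_approximable W e <->
  exists2 K, weakly_compact K & W `<=` set_add K (closed_ball 0 e).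
Proof.
move=> e0; split=> -[K K_cpt WK]; exists K => // w /WK.
  move=> [k Kk wk]; exists k => //; exists (w - k); last by rewrite addrC subrK.
  exact/closed_ball0P.
move=> [k Kk [u /(closed_ball0P _ e0) ue <-]]; exists k => //.
by rewrite addrAC subrr add0r.
Qed.

Lemma de_blasi_le W (e : R) : 0 < e -> weakly_approximable W e -> de_blasi W <= e.
Proof.
move=> e0 /(weakly_approximableP _ e0) We; apply: ge_inf => //.
by exists 0 => d [/ltW].
Qed.

Lemma weakly_compact_set1 x : weakly_compact [set x].
Proof. exact: (@compact_set1 wE). Qed.

Lemma de_blasi_has_inf W : bounded_set W ->
  has_inf [set e : R | 0 < e /\ exists2 K, weakly_compact K &
    W `<=` set_add K (closed_ball 0 e)].
Proof.
move=> /bounded_setP[M WM]; split; last by exists 0 => d [/ltW].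
have M0 : 0 < `|M| + 1 by rewrite ltr_wpDl.
exists (`|M| + 1); split => //; apply/weakly_approximableP => //.
exists [set 0]; first exact: weakly_compact_set1.
move=> w /WM wM; exists 0 => //; rewrite subr0 (le_trans wM)//.
by rewrite (le_trans (ler_norm _))// lerDl.
Qed.

Lemma de_blasi_lt W (e : R) : bounded_set W -> de_blasi W < e ->
  exists2 d, 0 < d < e & weakly_approximable W d.
Proof.
move=> W_bd We; have [d [d0 Wd] de] := inf_lt (de_blasi_has_inf W_bd).1 We.
by exists d; [rewrite d0|apply/weakly_approximableP].
Qed.

(** An ultrafilter on the image is transported to both factors by a choice of preimages, and the two
    weak limits are recombined. *)
Lemma weakly_compact_affine K1 K2 (a : R) x : weakly_compact K1 ->
  weakly_compact K2 ->
  weakly_compact [set a *: (u + v) + x | u in K1 & v in K2].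
Proof.
move=> /weakly_compactP K1_cpt /weakly_compactP K2_cpt.
apply/weakly_compactP => U U_ultra; set K := image2 _ _ _ => UK.
have /choice[uv uvP] (w : E) : exists uv : E * E,
    K w -> [/\ K1 uv.1, K2 uv.2 & a *: (uv.1 + uv.2) + x = w].
  have [[u K1u [v K2v uvw]]|nKw] := pselect (K w); last by exists (0, 0) => /nKw.
  by exists (u, v).
have [|u K1u uU] := K1_cpt ((fun w => (uv w).1) @ U) (ultra_fmap _ U_ultra).
  by rewrite fmapE; apply: filterS UK => w /uvP[].
have [|v K2v vU] := K2_cpt ((fun w => (uv w).2) @ U) (ultra_fmap _ U_ultra).
  by rewrite fmapE; apply: filterS UK => w /uvP[].
exists (a *: (u + v) + x); first by exists u => //; exists v.
apply/weak_cvgP => f f1.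
have fE y z : f (a *: (y + z) + x) = a * ((f y : R) + f z) + f x.
  by rewrite linearD linearZ linearD.
rewrite fE.
have fu : (fun w => f (uv w).1 : R) @ U --> (f u : R).
  by have /weak_cvgP/(_ f f1) := uU.
have fv : (fun w => f (uv w).2 : R) @ U --> (f v : R).
  by have /weak_cvgP/(_ f f1) := vU.
apply: cvg_trans (cvgD (cvgMl_tmp (a := a) (cvgD fu fv)) (cvg_cst (f x : R))).
apply: near_eq_cvg; apply: filterS UK => w /uvP[_ _ wE].
by rewrite -[in RHS]wE fE.
Qed.

End de_blasi_measure.

Section weak_sequences.
Context {R : realType} {E : normedModType R}.
Implicit Types (x y : E) (u v : nat -> E) (S : set E).

Lemma weakly_cvg_to_cst x : weakly_cvg_to (fun=> x) x.
Proof. by apply/weakly_cvg_toP => f _; exact: cvg_cst. Qed.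

Lemma weakly_cvg_to_affine u v x y (a b : R) :
  weakly_cvg_to u x -> weakly_cvg_to v y ->
  weakly_cvg_to (fun n => a *: u n + b *: v n) (a *: x + b *: y).
Proof.
move=> /weakly_cvg_toP ux /weakly_cvg_toP vy; apply/weakly_cvg_toP => f f1.
rewrite functionalP; under eq_fun do rewrite functionalP.
by apply: cvgD; apply: cvgMl_tmp; [exact: ux|exact: vy].
Qed.

Lemma weakly_cvg_toB u v x y : weakly_cvg_to u x -> weakly_cvg_to v y ->
  weakly_cvg_to (fun n => u n - v n) (x - y).
Proof.
move=> ux vy; have := @weakly_cvg_to_affine u v x y 1 (-1) ux vy.
by rewrite scale1r scaleN1r; under eq_fun do rewrite scale1r scaleN1r.
Qed.

Lemma weakly_cvg_toD u v x y : weakly_cvg_to u x -> weakly_cvg_to v y ->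
  weakly_cvg_to (fun n => u n + v n) (x + y).
Proof.
move=> ux vy; have := @weakly_cvg_to_affine u v x y 1 1 ux vy.
by rewrite !scale1r; under eq_fun do rewrite !scale1r.
Qed.

Lemma weakly_cvg_to_closed S u x : closed S -> convex_set S ->
  (forall n, S (u n)) -> weakly_cvg_to u x -> S x.
Proof.
move=> S_closed S_cvx Su ux; apply: (mazur S_closed S_cvx) => A /ux[N _ NA].
by exists (u N); split => //; exact: (NA N (leqnn N)).
Qed.

End weak_sequences.

Section sum_of_mappings.
Context {R : realType} {E : normedModType R}.
Variables (S : set E) (A B : E -> set E).
Hypotheses (A_values : closed_convex_valued S A).
Hypotheses (B_values : closed_convex_valued S B).
Hypotheses (A_graph : weakly_seq_closed_graph S A).
Hypotheses (B_graph : weakly_seq_closed_graph S B).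
Hypotheses (B_compact : weakly_compact_mapping S B).

Lemma compact_image_cover W : W `<=` S -> bounded_set W ->
  exists2 K, weakly_compact K & mv_image B W `<=` K.
Proof.
by move=> WS W_bd; have [K BK [K_cpt _]] := B_compact WS W_bd; exists K.
Qed.

(** A weakly convergent sequence is bounded, so the summands from [B] lie in a weakly compact set
    and converge along a subsequence; the summands from [A] then converge as differences. *)
Lemma sum_graph : weakly_seq_closed_graph S (mv_add A B).
Proof.
move=> x_ s_ x s Sx_ Sx x_x ABs s_s.
have /choice[b bP] n : exists b, B (x_ n) b /\ A (x_ n) (s_ n - b).
  by have [a Aa [b Bb <-]] := ABs n; exists b; rewrite addrK.
have [M x_M] := weakly_cvg_bounded x_x.
have x_bd : bounded_set (range x_).
  by apply/bounded_setP; exists M => _ [n _ <-].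
have x_S : range x_ `<=` S by move=> _ [n _ <-].
have [K K_cpt BK] := compact_image_cover x_S x_bd.
have [|k k_incr [b' Kb' b_b']] := @weakly_compact_subseq R E K b K_cpt.
  by move=> n; apply: BK; exists (x_ n); [exists n|exact: (bP n).1].
have xk := weakly_cvg_to_subseq k_incr x_x.
have sk := weakly_cvg_to_subseq k_incr s_s.
exists (s - b'); last first.
  exists b'; last by rewrite subrK.
  apply: (B_graph _ Sx xk _ b_b') => n; [exact: Sx_|exact: (bP (k n)).1].
apply: (A_graph _ Sx xk _ (weakly_cvg_toB sk b_b')) => n; first exact: Sx_.
exact: (bP (k n)).2.
Qed.

Lemma sum_values : closed_convex_valued S (mv_add A B).
Proof.
move=> x Sx; have [[a Aa] _ /convex_setP A_cvx] := A_values Sx.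
have [[b Bb] _ /convex_setP B_cvx] := B_values Sx; split.
- by exists (a + b), a => //; exists b.
- move=> s /closure_normP ABs.
  have /choice[s_ s_P] (n : nat) : exists t, mv_add A B x t /\ `|s - t| < n.+1%:R^-1.
    by have [|t ABt st] := ABs n.+1%:R^-1; [rewrite invr_gt0|exists t].
  (* A value is closed because the graph is closed along a constant sequence. *)
  apply: (sum_graph (x_ := fun=> x) (y_ := s_)) => //.
  + exact: weakly_cvg_to_cst.
  + by move=> n; exact: (s_P n).1.
  apply/weakly_cvg_toP => f f1; apply/cvgrPdist_lt => e e0; near=> n.
  rewrite -functionalB; apply: le_lt_trans (f1 _) _.
  apply: lt_trans (s_P n).2 _.
  by near: n; exact: (near_infty_natSinv_lt (PosNum e0)).
- apply/convex_setP => _ _ t [a1 Aa1 [b1 Bb1 <-]] [a2 Aa2 [b2 Bb2 <-]] t0 t1.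
  exists (t *: a1 + (1 - t) *: a2); first exact: A_cvx.
  exists (t *: b1 + (1 - t) *: b2); first exact: B_cvx.
  by rewrite !scalerDr addrACA.
Unshelve. all: by end_near. Qed.

End sum_of_mappings.

(** * The fixed point theorem *)

Lemma weakly_compact_closure_hull (R : realType) (E : completeNormedModType R)
    (W : set E) (M : R) : (forall x, W x -> `|x| <= M) ->
  convex_set (closure W) -> (forall e : R, 0 < e -> weakly_approximable W e) ->
  weakly_compact (closure W).
Proof.
move=> WM W_cvx W_approx; apply: weakly_ultra_cvg_compact => //.
  exact: closed_closure.
have cl_approx x (e : R) : closure W x -> 0 < e -> exists2 y, W y & `|x - y| <= e.
  by move=> /closure_normP Wx e0; have [y Wy /ltW] := Wx e e0; exists y.
apply: (@weakly_ultra_cvg_approx _ _ _ (M + 1)).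
  move=> x /cl_approx /(_ ltr01)[y /WM yM xy].
  by have := ler_normD (x - y) y; rewrite subrK; lra.
move=> e e0; have e2 : 0 < e / 2 by rewrite divr_gt0.
have [K K_cpt WK] := W_approx _ e2; exists K.
  exact: weakly_compact_ultra_cvg.
move=> x /cl_approx /(_ e2)[y /WK[k Kk yk] xy]; exists k => //.
by rewrite (splitr e) (le_trans (ler_distD y _ _))// lerD.
Qed.

(** * Solutions of the relaxed inclusion *)

Section relaxation.
Context {R : realType} {E : completeNormedModType R}.
Variables (S : set E) (A B : E -> set E) (Phi : R -> R).
Hypotheses (S_closed : closed S) (S_convex : convex_set S).
Hypotheses (A_values : closed_convex_valued S A).
Hypotheses (B_values : closed_convex_valued S B).
Hypotheses (A_graph : weakly_seq_closed_graph S A).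
Hypotheses (B_graph : weakly_seq_closed_graph S B).
Hypotheses (A_lipschitz : countably_D_set_lipschitzian S A Phi).
Hypotheses (B_compact : weakly_compact_mapping S B).
Hypotheses (AB_bounded : bounded_set (mv_image (mv_add A B) S)).
Hypotheses (AB_sub : mv_image (mv_add A B) S `<=` S).
Hypotheses (Phi_le : forall r : R, 0 < r -> Phi r <= r).

(** The Lipschitz condition on [A] asks for a bounded image. A value of [A] is a value of the
    bounded [A + B] minus one of [B], which lies in a weakly compact set. *)
Lemma bounded_image_A W : W `<=` S -> bounded_set W -> bounded_set (mv_image A W).
Proof.
move=> WS W_bd; have [K K_cpt BK] := compact_image_cover B_compact WS W_bd.
have [N KN] := weakly_compact_bounded K_cpt.
have [M ABM] := (bounded_setP _).1 AB_bounded.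
apply/bounded_setP; exists (M + N) => a [x Wx Aa].
have [[b Bb] _ _] := B_values (WS x Wx).
have abM : `|a + b| <= M.
  by apply: ABM; exists x; [exact: WS|exists a => //; exists b].
have bN : `|b| <= N by apply/KN/BK; exists x.
by rewrite -[a](addrK b) (le_trans (ler_normB _ _))// lerD.
Qed.

Section fixed_parameter.
Variables (lam : R) (x0 : E) (lam0 : 0 < lam) (lam1 : lam < 1) (Sx0 : S x0).
Variables (a b f : E -> E).
Hypotheses (Aa : forall x, S x -> A x (a x)) (Bb : forall x, S x -> B x (b x)).
Hypotheses (fE : forall x, S x -> f x = lam *: (a x + b x) + (1 - lam) *: x0).

Let C := midpoint_hull f [set x0].

Lemma relaxed_hull_sub : C `<=` S.
Proof.
move/convex_setP: S_convex => S_cvx.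
move=> x; elim=> {x} [_ ->//|x _ Sx|x y _ Sx _ Sy].
  rewrite fE//; apply: S_cvx => //; try exact: ltW.
  by apply: AB_sub; exists x => //; exists (a x); [exact: Aa|exists (b x); [exact: Bb|]].
have := S_cvx x y 2^-1 Sx Sy.
have -> : 1 - 2^-1 = 2^-1 :> R by field.
by rewrite -scalerDr; apply; lra.
Qed.

Lemma relaxed_hull_bounded : exists M : R, forall x, C x -> `|x| <= M.
Proof.
have [M ABM] := (bounded_setP _).1 AB_bounded.
exists (Num.max M `|x0|) => x; elim=> {x} [_ ->|x Cx _|x y _ xM _ yM].
- by rewrite le_max lexx orbT.
- have Sx := relaxed_hull_sub Cx; rewrite fE//.
  rewrite (le_trans (ler_normD _ _))// !normrZ !gtr0_norm ?subr_gt0//.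
  have abM : `|a x + b x| <= Num.max M `|x0|.
    rewrite le_max ABM//; exists x => //; exists (a x); first exact: Aa.
    by exists (b x) => //; exact: Bb.
  have x0M : `|x0| <= Num.max M `|x0| by rewrite le_max lexx orbT.
  move: (Num.max _ _) abM x0M => N abN x0N.
  have l1 : 0 <= 1 - lam by rewrite subr_ge0 ltW.
  apply: le_trans (lerD (ler_wpM2l (ltW lam0) abN) (ler_wpM2l l1 x0N)) _.
  by rewrite -mulrDl addrC subrK mul1r.
- rewrite /midpoint normrZ gtr0_norm ?invr_gt0//.
  by have := ler_normD x y; lra.
Qed.

(* [C] lies in the hull of [x0] and [f C], whose measure of noncompactness is
   at most [lam * de_blasi C]. *)
Lemma relaxed_hull_de_blasi : de_blasi C <= 0.
Proof.
have [M CM] := relaxed_hull_bounded.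
have C_bd : bounded_set C by apply/bounded_setP; exists M.
have C_countable : countable C by exact: midpoint_hull_countable.
have [_ A_lip] := A_lipschitz.
rewrite leNgt; apply/negP => C0; set beta := de_blasi C in C0.
have AC_bd := bounded_image_A relaxed_hull_sub C_bd.
(* Chosen so that [lam * e < beta < e]. *)
pose e := beta * 2 / (1 + lam).
have lamD : 0 < 1 + lam by rewrite addr_gt0.
have beta_e : beta < e.
  by rewrite /e ltr_pdivlMr// ltr_pM2l//; move: lam1; lra.
have e_beta : lam * e < beta.
  by rewrite /e mulrA ltr_pdivrMr// mulrCA ltr_pM2l//; move: lam1; lra.
have AC_lt : de_blasi (mv_image A C) < e.
  apply: le_lt_trans beta_e; apply: le_trans (Phi_le C0).
  by apply: A_lip => //; exact: relaxed_hull_sub.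
have [d /andP[d0 de] [K1 K1_cpt AK1]] := de_blasi_lt AC_bd AC_lt.
have [K2 K2_cpt BK2] := compact_image_cover B_compact relaxed_hull_sub C_bd.
have /choice[k kP] x : exists k, C x -> K1 k /\ `|a x - k| <= d.
  have [Cx|nCx] := pselect (C x); last by exists 0 => /nCx.
  have [|y K1y ay] := AK1 (a x); last by exists y.
  by exists x => //; apply/Aa/relaxed_hull_sub.
(* This is [f] with the value of [A] replaced by an approximant in [K1]: its image of [C] lies in a
   weakly compact set, and it differs from [f] by at most [lam * d] on [C]. *)
pose g x := lam *: (k x + b x) + (1 - lam) *: x0.
pose G := [set x0] `|` g @` C.
pose K3 := [set lam *: (u + v) + (1 - lam) *: x0 | u in K1 & v in K2].
have K3_cpt : weakly_compact ([set x0] `|` K3).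
  apply: (@compactU (weak_space E)); first exact: weakly_compact_set1.
  exact: weakly_compact_affine.
have GK3 : G `<=` [set x0] `|` K3.
  move=> _ [->|[x Cx <-]]; [by left|right; exists (k x); first exact: (kP x Cx).1].
  by exists (b x) => //; apply: BK2; exists x => //; apply/Bb/relaxed_hull_sub.
have G_countable : countable G.
  by apply: countableU => //; exact: sub_countable (card_image_le _ _) C_countable.
have G0 : G !=set0 by exists x0; left.
have hull_cpt := krein_smulian K3_cpt G_countable G0 GK3.
have C_near x : C x -> exists2 h, midpoint_hull id G h & `|x - h| <= lam * d.
  elim=> {x} [_ ->|x Cx _|x y _ [h Gh xh] _ [i Gi yi]].
  - exists x0; first by apply: Hull_base; left.
    by rewrite subrr normr0 mulr_ge0// ltW.
  - exists (g x); first by apply: Hull_base; right; exists x.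
    rewrite fE; last exact: relaxed_hull_sub.
    rewrite opprD addrACA subrr addr0 -scalerBr opprD addrACA subrr addr0.
    by rewrite normrZ gtr0_norm// ler_wpM2l ?(kP x Cx).2// ltW.
  - exists (midpoint h i); first exact: Hull_mid.
    rewrite /midpoint -scalerBr normrZ gtr0_norm ?invr_gt0// opprD addrACA.
    by have := ler_normD (x - h) (y - i); lra.
pose e' := (lam * e + beta) / 2.
have lam_e : 0 < lam * e by rewrite mulr_gt0// (lt_trans d0).
have lam_de : lam * d <= lam * e by rewrite ler_wpM2l// ltW.
have : beta <= e'.
  apply: de_blasi_le; first by rewrite divr_gt0// addr_gt0.
  exists (closure (midpoint_hull id G)) => // x /C_near[h Gh xh].
  exists h; first exact: subset_closure.
  by rewrite (le_trans xh)// /e'; lra.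
by rewrite /e'; lra.
Qed.

Lemma relaxed_hull_weakly_compact : weakly_compact (closure C).
Proof.
have [M CM] := relaxed_hull_bounded.
apply: (weakly_compact_closure_hull CM) => [|e e0].
  by apply: closure_midpoint_convex => x y; exact: Hull_mid.
have C_bd : bounded_set C by apply/bounded_setP; exists M.
have [d /andP[d0 de] [K K_cpt CK]] :=
  de_blasi_lt C_bd (le_lt_trans relaxed_hull_de_blasi e0).
exists K => // x /CK[k Kk xk]; exists k => //; exact: le_trans xk (ltW de).
Qed.

Lemma fixed_parameter_solution : exists2 u, S u &
  exists2 v, mv_add A B u v & u = lam *: v + (1 - lam) *: x0.
Proof.
have C0 : C !=set0 by exists x0; exact: Hull_base.
have C_countable : countable C by exact: midpoint_hull_countable.
have [p p1 p_sep] := separating_functionals C_countable C0.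
have C_cvx : convex_set (closure C).
  by apply: closure_midpoint_convex => x y; exact: Hull_mid.
have C_f x : C x -> C (f x) by exact: Hull_map.
have clCS : closure C `<=` S.
  by rewrite (closure_id S).1//; apply: closureS; exact: relaxed_hull_sub.
have [z Cz zP] := @halfspace_fixed_point R E C f p C_countable C0 C_f C_cvx
  relaxed_hull_weakly_compact p1 p_sep.
have Sz := clCS z Cz; exists z => //.
have lam_neq0 : lam != 0 by rewrite gt_eqF.
(* The point whose relaxation is [z]; it has to be a value of [A + B] at [z]. *)
pose v := lam^-1 *: (z - (1 - lam) *: x0).
have vE : z = lam *: v + (1 - lam) *: x0.
  by rewrite /v scalerA divff// scale1r subrK.
exists v => //; apply: contrapT => nABv.
have [AB0 AB_closed AB_cvx] :=
  sum_values A_values B_values A_graph B_graph B_compact Sz.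
have [h h1 [r r0 hr]] := closed_convex_separation AB0 AB_closed AB_cvx nABv.
(* Relaxation shrinks the separating gap [r] to [lam * r], which the weak limits of [f] at [z]
   respect; no half-space separates [z] from these limits, so [z] would respect it too. *)
suff : h z <= (h z : R) - lam * r.
  by rewrite lerBrDr gerDl leNgt mulr_gt0.
apply: zP => // u g Cu uz fg.
have Su n : S (u n) by exact: relaxed_hull_sub.
pose w n := lam^-1 *: f (u n) + (- (lam^-1 * (1 - lam))) *: x0.
have wE n : w n = a (u n) + b (u n).
  rewrite /w fE// scalerDr !scalerA mulVf// scale1r scaleNr addrK.
  by [].
pose g' := lam^-1 *: g + (- (lam^-1 * (1 - lam))) *: x0.
have wg : weakly_cvg_to w g'.
  exact (@weakly_cvg_to_affine R E (f \o u) (fun=> x0) g x0 lam^-1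
    (- (lam^-1 * (1 - lam))) fg (@weakly_cvg_to_cst R E x0)).
have ABg' : mv_add A B z g'.
  apply: (sum_graph A_graph B_graph B_compact) uz _ wg => // n.
  rewrite wE; exists (a (u n)); first exact: Aa.
  by exists (b (u n)) => //; exact: Bb.
have gE : g = lam *: g' + (1 - lam) *: x0.
  rewrite /g' scalerDr !scalerA divff// scale1r mulrN mulrA divff// mul1r.
  by rewrite scaleNr subrK.
rewrite gE {1}vE (functionalP h lam _ g') (functionalP h lam _ v).
have := hr _ ABg'.
move: (h g' : R) (h v : R) (h x0 : R) => c1 c2 c3 h12.
have : lam * c1 <= lam * (c2 - r) by rewrite ler_wpM2l// ltW.
by lra.
Qed.

End fixed_parameter.

Lemma relaxed_solution (lam : R) (x0 : E) : 0 < lam -> lam < 1 -> S x0 ->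
  exists2 u, S u & exists2 v, mv_add A B u v & u = lam *: v + (1 - lam) *: x0.
Proof.
move=> lam0 lam1 Sx0.
have /choice[a aP] x : exists a, S x -> A x a.
  have [/A_values[[a Aa] _ _]|nSx] := pselect (S x); first by exists a.
  by exists 0 => /nSx.
have /choice[b bP] x : exists b, S x -> B x b.
  have [/B_values[[b Bb] _ _]|nSx] := pselect (S x); first by exists b.
  by exists 0 => /nSx.
exact: (fixed_parameter_solution lam0 lam1 Sx0 aP bP (fun x _ => erefl)).
Qed.

End relaxation.

Theorem theorem3p2 (R : realType) (E : completeNormedModType R)
    (S : set E) (A B : E -> set E) (Phi : R -> R)
    (S_neq0 : S !=set0) (S_closed : closed S) (S_convex : convex_set S)
    (A_values : closed_convex_valued S A)
    (B_values : closed_convex_valued S B)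
    (A_graph : weakly_seq_closed_graph S A)
    (B_graph : weakly_seq_closed_graph S B)
    (A_hemi : hemi_weakly_compact S A)
    (A_lipschitz : countably_D_set_lipschitzian S A Phi)
    (B_compact : weakly_compact_mapping S B)
    (AB_bounded : bounded_set (mv_image (mv_add A B) S))
    (AB_sub : mv_image (mv_add A B) S `<=` S)
    (Phi_le : forall r : R, 0 < r -> Phi r <= r) :
  exists2 u : E, S u & mv_add A B u u.
Proof.
have [x0 Sx0] := S_neq0.
have [M ABM] := (bounded_setP _).1 AB_bounded.
(* The shift by 2 keeps [1 - eps n] strictly between 0 and 1 from [n = 0] on. *)
pose eps n : R := n.+2%:R^-1.
have eps0 n : 0 < eps n by rewrite invr_gt0.
have eps1 n : eps n < 1 by rewrite invf_lt1// ltr1n.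
have /choice[uab uabP] n : exists uab : E * E * E, [/\ S uab.1.1,
    A uab.1.1 uab.1.2, B uab.1.1 uab.2 &
    uab.1.1 = (1 - eps n) *: (uab.1.2 + uab.2) + eps n *: x0].
  have l0 : 0 < 1 - eps n by rewrite subr_gt0.
  have l1 : 1 - eps n < 1 by rewrite gtrBl.
  have [u Su [_ [a Aa [b Bb <-]] uE]] := relaxed_solution S_closed S_convex
    A_values B_values A_graph B_graph A_lipschitz B_compact AB_bounded AB_sub
    Phi_le l0 l1 Sx0.
  by exists (u, a, b); split => //=; rewrite {1}uE subKr.
pose u n := (uab n).1.1; pose a n := (uab n).1.2; pose b n := (uab n).2.
have Su n : S (u n) by have [] := uabP n.
have Aa n : A (u n) (a n) by have [] := uabP n.
have Bb n : B (u n) (b n) by have [] := uabP n.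
pose s n := a n + b n.
have ABs n : mv_add A B (u n) (s n) by exists (a n); [|exists (b n)].
have sM n : `|s n| <= M by apply: ABM; exists (u n).
have M0 : 0 <= M by exact: le_trans (sM 0%N).
have us n : u n - s n = eps n *: (x0 - s n).
  have [_ _ _] := uabP n; rewrite -/(u n) -/(a n) -/(b n) -/(s n) => ->.
  by rewrite scalerBl scale1r scalerBr addrAC [s n - _]addrC addrK addrC.
have us_le n : `|u n - s n| <= eps n * (`|x0| + M).
  rewrite us normrZ gtr0_norm// ler_wpM2l//; first exact: ltW.
  by rewrite (le_trans (ler_normB _ _))// lerD2l.
have us_weak : weakly_cvg_to (fun n => u n - s n) 0.
  apply/weakly_cvg_toP => f f1; apply/cvgrPdist_lt => e e0.
  have c0 : 0 < `|x0| + M + 1 by rewrite ltr_wpDl// addr_ge0.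
  have [N _ NP] := near_infty_natSinv_lt (PosNum (divr_gt0 e0 c0)).
  exists N => // n /NP /= ne; rewrite -functionalB sub0r.
  apply: le_lt_trans (f1 _) _; rewrite normrN.
  apply: le_lt_trans (us_le n) _; rewrite ltr_pdivlMr// in ne.
  apply: le_lt_trans ne; apply: ler_pM => //; [exact: ltW|exact: addr_ge0| |].
    by rewrite lef_pV2 ?posrE// ler_nat.
  by rewrite lerDl.
have u_bd : bounded_set (range u).
  apply/bounded_setP; exists (`|x0| + M + M) => _ [n _ <-].
  rewrite -[u n](subrK (s n)) (le_trans (ler_normD _ _))// lerD//.
  by rewrite (le_trans (us_le n))// ler_piMl ?addr_ge0// ltW.
have u_S : range u `<=` S by move=> _ [n _ <-].
have [K K_cpt BK] := compact_image_cover B_compact u_S u_bd.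
have [|k k_incr [b0 _ kb]] := @weakly_compact_subseq R E K b K_cpt.
  by move=> n; apply: BK; exists (u n) => //; exists n.
have usk := weakly_cvg_to_subseq k_incr us_weak.
have [|||l l_incr [x ux]] := A_hemi (u \o k) (a \o k).
- by move=> n; exact: Su.
- by move=> n; exact: Aa.
(* Here [u - a = (u - s) + b], where [u - s] tends to 0 and [b] converges weakly along [k]. *)
- exists (0 + b0); have := weakly_cvg_toD usk kb.
  congr weakly_cvg_to; apply/funext => n /=.
  by rewrite /s opprD addrA subrK.
have Sx : S x by apply: (weakly_cvg_to_closed S_closed S_convex _ ux) => n; exact: Su.
exists x => //.
(* Written as [u - (u - s)], the sequence [s] has the same weak limit as [u]. *)
have sx := weakly_cvg_toB ux (weakly_cvg_to_subseq l_incr usk).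
rewrite subr0 in sx.
apply: (sum_graph A_graph B_graph B_compact _ Sx ux _ sx) => n; first exact: Su.
by rewrite /= subKr; exact: ABs.
Qed.
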